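(* Let $F$ be a finite field with $|F|=q$ and $\operatorname{char}F=p>2$, let $k\geq 0$ be an integer, and let $G_{k^*}$ be the infinite-dimensional unitary Grassmann algebra $G$ over $F$ with the $\mathbb{Z}_2$-grading induced by the automorphism $\phi_{k^*}$ given by $e_i\mapsto -e_i$ for $1\le i\le k$ and $e_i\mapsto e_i$ for $i\geq k+1$. Then $T_2(G_{k^*})=I_3$, where $I_3$ is the $T_2$-ideal of $F\langle X\rangle$ generated by the polynomials $$[x_1,x_2,x_3],\qquad z_1z_2\cdots z_{k+1},\qquad z_1^{p},\qquad y_1^{pq}-y_1^{p}.$$
   Context: $G$ is the unitary Grassmann algebra over $F$ generated by $e_1,e_2,\ldots$ subject to $e_ie_j=-e_je_i$ for all $i,j$; it has $F$-basis consisting of $1$ and the products $e_{i_1}\cdots e_{i_n}$ with $i_1<\cdots<i_n$. An automorphism $\phi$ of $G$ with $\phi^2=\mathrm{id}$ induces the $\mathbb{Z}_2$-grading $G=G_0\oplus G_1$ with $G_0=\{2^{-1}(a+\phi(a)) : a\in G\}$ (even component) and $G_1=\{2^{-1}(a-\phi(a)) : a\in G\}$ (odd component); for $k=0$ the grading is the trivial one. $F\langle X\rangle$ is the free unitary associative algebra on $X=Y\cup Z$, $Y=\{y_1,y_2,\ldots\}$, $Z=\{z_1,z_2,\ldots\}$ (disjoint countable sets), $\mathbb{Z}_2$-graded by giving each $y_i$ degree $0$ and each $z_i$ degree $1$. The letters $x_1,x_2,x_3$ stand for arbitrary variables of $X$ (so $[x_1,x_2,x_3]$ denotes all the polynomials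 obtained by letting each $x_i$ be an element of $Y$ or of $Z$). For a $\mathbb{Z}_2$-graded algebra $A=A_0\oplus A_1$, $T_2(A)$ is the set of $\mathbb{Z}_2$-graded polynomial identities of $A$: the polynomials in $F\langle X\rangle$ that vanish under all substitutions of elements of $A_0$ for the $y$'s and of $A_1$ for the $z$'s. A $T_2$-ideal is a (two-sided) ideal of $F\langle X\rangle$ stable under all endomorphisms $\phi$ of $F\langle X\rangle$ with $\phi(F\langle X\rangle_i)\subset F\langle X\rangle_i$, $i=0,1$; the $T_2$-ideal generated by a set $S$ is the intersection of all $T_2$-ideals containing $S$. $[a,b]=ab-ba$ and $[a,b,c]=[[a,b],c]$. *)

(* Defs.v *)
From HB Require Import structures.
From mathcomp Require Import all_boot all_order all_algebra.
From mathcomp Require Import boolp classical_sets.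
From mathcomp Require Import finmap.
From mathcomp Require Import monalg.

Set Implicit Arguments.
Unset Strict Implicit.
Unset Printing Implicit Defensive.

Import GRing.Theory.
Local Open Scope fset_scope.
Local Open Scope ring_scope.

(* The linear map from the free module on K to V extending h. *)
HB.lock Definition lext (F : fieldType) (K : choiceType) (V : lmodType F)
  (h : K -> V) (a : {malg F[K]}) : V := \sum_(k <- msupp a) a@_k *: h k.

Section LinearExtension.
Context (F : fieldType) (K : choiceType) (V : lmodType F).
Implicit Types (h : K -> V) (a : {malg F[K]}).

Lemma lextE h a : lext h a = \sum_(k <- msupp a) a@_k *: h k.
Proof. by rewrite lext.unlock. Qed.

Lemma lextEw h a (d : {fset K}) :
  msupp a `<=` d -> lext h a = \sum_(k <- d) a@_k *: h k.
Proof.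
move=> le; rewrite lextE; apply: big_fset_incl => // k _ kN.
by rewrite (mcoeff_outdom kN) scale0r.
Qed.

Lemma lext_is_linear h : linear (lext h).
Proof.
move=> c a b; pose d := msupp a `|` msupp b `|` msupp (c *: a + b).
rewrite !(@lextEw h _ d).
- rewrite scaler_sumr -big_split /=; apply: eq_bigr => k _.
  by rewrite mcoeffD mcoeffZ scalerDl scalerA.
- by rewrite /d -fsetUA fsetUCA fsubsetUl.
- by rewrite /d -fsetUA fsubsetUl.
- by rewrite /d fsubsetUr.
Qed.

HB.instance Definition _ h :=
  GRing.isLinear.Build F {malg F[K]} V *:%R (lext h) (lext_is_linear h).

Lemma lextU h k : lext h << k >> = h k.
Proof.
by rewrite (@lextEw _ _ [fset k]) ?msuppU_le // big_seq_fset1 mcoeffUU scale1r.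
Qed.

Lemma eq_lext h1 h2 : h1 =1 h2 -> lext h1 =1 lext h2.
Proof. by move=> e a; rewrite !lextE; apply: eq_bigr => k _; rewrite e. Qed.

Lemma malg_ind (P : {malg F[K]} -> Prop) :
  P 0 -> (forall c k a, P a -> P (c *: << k >> + a)) -> forall a, P a.
Proof.
move=> P0 PD a; rewrite [a]monalgE; elim: (enum_fset _) => [|k s IH].
  by rewrite big_nil.
rewrite big_cons.
have <- : a@_k *: << k >> = << a@_k *g k >> :> {malg F[K]}; last first.
  exact: PD.
by apply/malgP => k'; rewrite mcoeffZ !mcoeffU mulr_natr.
Qed.

End LinearExtension.

(* The infinite-dimensional Grassmann algebra, realised on its monomial basis:
   the finite set {i_1 < ... < i_n} of naturals stands for e_{i_1} ... e_{i_n}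
   (see gbasis_prod, genM_anti). Indices start at 0: [gen F i] is e_{i+1}. *)
Definition grassmann (F : fieldType) := {malg F[{fset nat}]}.

HB.instance Definition _ (F : fieldType) := Choice.on (grassmann F).

(* The module structure is that of {malg F[{fset nat}]}; it is only sealed, as
   conversion otherwise unfolds the {malg _} operations. *)
HB.lock Definition gzero (F : fieldType) : grassmann F :=
  (0 : {malg F[{fset nat}]}).
HB.lock Definition gopp (F : fieldType) (a : grassmann F) : grassmann F :=
  - (a : {malg F[{fset nat}]}).
HB.lock Definition gadd (F : fieldType) (a b : grassmann F) : grassmann F :=
  (a : {malg F[{fset nat}]}) + b.
HB.lock Definition gscale (F : fieldType) (x : F) (a : grassmann F) :
  grassmann F := x *: (a : {malg F[{fset nat}]}).

Section GrassmannModule.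
Context (F : fieldType).
Local Notation G := (grassmann F).
Local Notation M := {malg F[{fset nat}]}.

Let gaddA : associative (@gadd F).
Proof. by move=> a b c; rewrite gadd.unlock addrA. Qed.
Let gaddC : commutative (@gadd F).
Proof. by move=> a b; rewrite gadd.unlock addrC. Qed.
Let gadd0 : left_id (gzero F) (@gadd F).
Proof. by move=> a; rewrite gadd.unlock gzero.unlock add0r. Qed.
Let gaddN : left_inverse (gzero F) (@gopp F) (@gadd F).
Proof. by move=> a; rewrite gadd.unlock gopp.unlock gzero.unlock addNr. Qed.

HB.instance Definition _ := GRing.isZmodule.Build G gaddA gaddC gadd0 gaddN.

Lemma grassmann0E : 0 = (0 : M) :> G.
Proof. exact: (congr1 (fun f => f F) gzero.unlock). Qed.
Lemma grassmannDE (a b : G) : a + b = (a : M) + (b : M) :> G.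
Proof. exact: (congr1 (fun f => f F a b) gadd.unlock). Qed.

Let gscaleA (x y : F) (a : G) : gscale x (gscale y a) = gscale (x * y) a.
Proof. by rewrite gscale.unlock scalerA. Qed.
Let gscale1 : left_id 1 (@gscale F).
Proof. by move=> a; rewrite gscale.unlock scale1r. Qed.
Let gscaleDr : right_distributive (@gscale F) +%R.
Proof. by move=> x a b; rewrite !grassmannDE gscale.unlock scalerDr. Qed.
Let gscaleDl (a : G) : {morph (@gscale F)^~ a : x y / x + y}.
Proof. by move=> x y; rewrite !grassmannDE gscale.unlock scalerDl. Qed.

HB.instance Definition _ := GRing.Zmodule_isLmodule.Build F G
  gscaleA gscale1 gscaleDr gscaleDl.

Lemma grassmannZE (x : F) (a : G) : x *: a = x *: (a : M) :> G.
Proof. exact: (congr1 (fun f => f F x a) gscale.unlock). Qed.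

Lemma lext_grassmann_is_linear (V : lmodType F) (h : {fset nat} -> V) :
  linear (lext h : G -> V).
Proof. by move=> x a b; rewrite grassmannDE grassmannZE lext_is_linear. Qed.

End GrassmannModule.

HB.lock Definition gbasis (F : fieldType) (S : {fset nat}) : grassmann F := << S >>.
Definition gen (F : fieldType) (i : nat) : grassmann F := gbasis F [fset i].

(* Number of transpositions needed to sort the concatenation of S and T. *)
Definition inversions (S T : {fset nat}) : nat :=
  \sum_(i <- S) \sum_(j <- T) (j < i)%N.

Definition gmul_basis (F : fieldType) (S T : {fset nat}) : grassmann F :=
  if [disjoint S & T]%fset then
    (-1) ^+ inversions S T *: gbasis F (S `|` T)
  else 0.

HB.lock Definition gmul (F : fieldType) (a b : grassmann F) : grassmann F :=
  lext (fun S : {fset nat} => lext (gmul_basis F S) b) a.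

(* The automorphism negating the first k generators and fixing the others
   (gphi_gen): the basis element of S gets one sign per element of S below k. *)
HB.lock Definition gphi (F : fieldType) (k : nat) : grassmann F -> grassmann F :=
  lext (fun S : {fset nat} => (-1) ^+ (\sum_(i <- S) (i < k)) *: gbasis F S).

Section Grassmann.
Context (F : fieldType).
Local Notation G := (grassmann F).
Local Notation gbasis := (gbasis F).
Local Notation gen := (gen F).
Local Notation gmul_basis := (gmul_basis F).
Local Notation gmul := (@gmul F).
Local Notation gphi := (@gphi F).
Implicit Types (S T U : {fset nat}) (a b c : G).

Lemma lext_gbasis (V : lmodType F) (h : {fset nat} -> V) S :
  lext h (gbasis S) = h S.
Proof. by rewrite gbasis.unlock lextU. Qed.

Lemma gmulUU S T : gmul (gbasis S) (gbasis T) = gmul_basis S T.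
Proof. by rewrite gmul.unlock !lext_gbasis. Qed.

Lemma gmul_linearl b : linear (gmul ^~ b).
Proof. rewrite gmul.unlock; exact: lext_grassmann_is_linear. Qed.

Lemma gmul_linearr a : linear (gmul a).
Proof.
move=> c b1 b2; rewrite gmul.unlock !(lextE _ a) scaler_sumr -big_split /=.
apply: eq_bigr => S _.
rewrite [lext _ _](lext_grassmann_is_linear (gmul_basis S) c b1 b2) scalerDr !scalerA.
by rewrite [_ * c]mulrC.
Qed.

Let gmul0l b : gmul 0 b = 0.
Proof. by have := gmul_linearl b (-1) 0 0; rewrite /= scaler0 addr0 scaleN1r addNr. Qed.

Let gmul0r a : gmul a 0 = 0.
Proof. by have := gmul_linearr a (-1) 0 0; rewrite scaler0 addr0 scaleN1r addNr. Qed.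

Let gmulPl x a b c : gmul (x *: a + b) c = x *: gmul a c + gmul b c.
Proof. exact: gmul_linearl. Qed.

Let gmulPr x a b c : gmul a (x *: b + c) = x *: gmul a b + gmul a c.
Proof. exact: gmul_linearr. Qed.

Let gmulZl x a b : gmul (x *: a) b = x *: gmul a b.
Proof. by rewrite -[x *: a]addr0 gmulPl gmul0l addr0. Qed.

Let gmulZr x a b : gmul a (x *: b) = x *: gmul a b.
Proof. by rewrite -[x *: b]addr0 gmulPr gmul0r addr0. Qed.

Lemma grassmann_ind (P : G -> Prop) :
  P 0 -> (forall (x : F) S a, P a -> P (x *: gbasis S + a)) -> forall a, P a.
Proof.
rewrite gbasis.unlock grassmann0E => P0 PD; apply: malg_ind => // x S a Pa.
by have := PD x S a Pa; rewrite grassmannDE grassmannZE.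
Qed.

Lemma sum_fsetU S T (f : nat -> nat) : [disjoint S & T]%fset ->
  \sum_(i <- S `|` T) f i = (\sum_(i <- S) f i + \sum_(i <- T) f i)%N.
Proof.
move=> /fdisjointP dST; rewrite -big_cat; apply: perm_big; apply: uniq_perm => //.
  rewrite cat_uniq !fset_uniq andbT; apply/hasPn => i iT.
  by apply: contraL iT => /dST.
by move=> i; rewrite mem_cat inE.
Qed.

Lemma inversionsUl S T U : [disjoint S & T]%fset ->
  inversions (S `|` T) U = (inversions S U + inversions T U)%N.
Proof. by move=> dST; rewrite /inversions sum_fsetU. Qed.

Lemma inversionsUr S T U : [disjoint T & U]%fset ->
  inversions S (T `|` U) = (inversions S T + inversions S U)%N.
Proof.
move=> dTU; rewrite /inversions -big_split; apply: eq_bigr => i _.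
by rewrite sum_fsetU.
Qed.

Let gmul_basisA S T U :
  gmul (gbasis S) (gmul (gbasis T) (gbasis U)) =
  gmul (gmul (gbasis S) (gbasis T)) (gbasis U).
Proof.
rewrite !gmulUU /gmul_basis.
case dST: [disjoint S & T]%fset.
  rewrite gmulZl gmulUU /gmul_basis fdisjointUX.
  case dTU: [disjoint T & U]%fset; last by rewrite andbF scaler0 gmul0r.
  rewrite gmulZr gmulUU /gmul_basis fdisjointXU dST andbT /=.
  case dSU: [disjoint S & U]%fset; last by rewrite !scaler0.
  rewrite !scalerA -!exprD fsetUA inversionsUl // inversionsUr //.
  by rewrite addnC addnA.
rewrite gmul0l; case dTU: [disjoint T & U]%fset; last by rewrite gmul0r.
by rewrite gmulZr gmulUU /gmul_basis fdisjointXU dST scaler0.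
Qed.

Fact gmulA : associative gmul.
Proof.
move=> a b c; elim/grassmann_ind: a => [|x S a IH]; first by rewrite !gmul0l.
rewrite 3!gmulPl IH; suff -> : gmul (gbasis S) (gmul b c) = gmul (gmul (gbasis S) b) c by [].
elim/grassmann_ind: b {IH} => [|y T b IH]; first by rewrite gmul0l !gmul0r gmul0l.
rewrite gmulPl 2!gmulPr gmulPl IH.
suff -> : gmul (gbasis S) (gmul (gbasis T) c) = gmul (gmul (gbasis S) (gbasis T)) c by [].
elim/grassmann_ind: c {IH} => [|z U c IH]; first by rewrite !gmul0r.
by rewrite 3!gmulPr IH gmul_basisA.
Qed.

Fact gmul1l : left_id (gbasis fset0) gmul.
Proof.
elim/grassmann_ind=> [|x S a IH]; first by rewrite gmul0r.
rewrite gmulPr IH gmulUU /gmul_basis fdisjoint0X fset0U.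
by rewrite /inversions big_seq_fset0 expr0 scale1r.
Qed.

Fact gmul1r : right_id (gbasis fset0) gmul.
Proof.
elim/grassmann_ind=> [|x S a IH]; first by rewrite gmul0l.
rewrite gmulPl IH gmulUU /gmul_basis fdisjointX0 fsetU0.
rewrite /inversions big1 ?expr0 ?scale1r // => i _; exact: big_seq_fset0.
Qed.

Fact gmulDl : left_distributive gmul +%R.
Proof. by move=> a b c; rewrite -[a]scale1r gmulPl !scale1r. Qed.

Fact gmulDr : right_distributive gmul +%R.
Proof. by move=> a b c; rewrite -[b]scale1r gmulPr !scale1r. Qed.

Fact gone_neq0 : gbasis fset0 != 0.
Proof. by rewrite gbasis.unlock grassmann0E (monalgU_eq0 (K := {fset nat})) oner_eq0. Qed.

HB.instance Definition _ := GRing.Zmodule_isNzRing.Build G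
  gmulA gmul1l gmul1r gmulDl gmulDr gone_neq0.

HB.instance Definition _ := GRing.Lmodule_isLalgebra.Build F G
  (fun x a b => esym (gmulZl x a b)).

HB.instance Definition _ := GRing.Lalgebra_isAlgebra.Build F G
  (fun x a b => esym (gmulZr x a b)).

Lemma gbasisM S T : gbasis S * gbasis T = gmul_basis S T.
Proof. exact: gmulUU. Qed.

Lemma gbasis0 : gbasis fset0 = 1.
Proof. by []. Qed.

Lemma genM_anti i j : gen i * gen j = - (gen j * gen i).
Proof.
rewrite !gbasisM /gmul_basis !fdisjoint1X !inE [j == i]eq_sym.
case: ltngtP => [ij|ij|] /=; rewrite ?oppr0 //; rewrite fsetUC;
  by rewrite /inversions !big_seq_fset1 ij ltnNge ltnW // ?expr1 expr0 ?scale1r scaleN1r ?opprK.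
Qed.

Lemma gen_sqr i : gen i * gen i = 0.
Proof. by rewrite gbasisM /gmul_basis fdisjoint1X !inE eqxx. Qed.

Lemma gbasis_prod (s : seq nat) :
  sorted ltn s -> \prod_(i <- s) gen i = gbasis [fset i in s].
Proof.
elim: s => [|i s IH]; first by rewrite big_nil fset_nil.
rewrite /= (path_sortedE ltn_trans) => /andP[/allP lti srt].
have iNs : i \notin s by apply/negP => /lti; rewrite ltnn.
rewrite big_cons IH // gbasisM /gmul_basis fdisjoint1X !inE iNs fset_cons.
rewrite /inversions big_seq_fset1 big_seq big1 ?expr0 ?scale1r // => j.
by rewrite !inE => /lti /ltnW; rewrite leqNgt => /negbTE ->.
Qed.

Lemma gphi_basis k S :
  gphi k (gbasis S) = (-1) ^+ (\sum_(i <- S) (i < k)) *: gbasis S.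
Proof. by rewrite gphi.unlock lext_gbasis. Qed.

Lemma gphi_gen k i : gphi k (gen i) = if (i < k)%N then - gen i else gen i.
Proof.
by rewrite gphi_basis big_seq_fset1; case: ltnP => _; rewrite ?scaleN1r ?scale1r.
Qed.

Fact gphi_is_linear k : linear (gphi k).
Proof. rewrite gphi.unlock; exact: lext_grassmann_is_linear. Qed.

HB.instance Definition _ k :=
  GRing.isLinear.Build F G G *:%R (gphi k) (gphi_is_linear k).

Fact gphi_is_monoid_morphism k : monoid_morphism (gphi k).
Proof.
split; first by rewrite gphi_basis big_seq_fset0 expr0 scale1r.
elim/grassmann_ind=> [b|x S a IH b]; first by rewrite raddf0 !mul0r raddf0.
rewrite mulrDl -scalerAl !gphi_is_linear mulrDl -scalerAl IH; congr (_ *: _ + _).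
elim/grassmann_ind: b => [|y T b IHb]; first by rewrite raddf0 !mulr0 raddf0.
rewrite mulrDr -scalerAr !gphi_is_linear mulrDr -scalerAr IHb; congr (_ *: _ + _).
rewrite gbasisM !gphi_basis -scalerAl -scalerAr gbasisM /gmul_basis.
case: ifP => dST; last by rewrite raddf0 !scaler0.
by rewrite linearZ /= gphi_basis !scalerA sum_fsetU // -!exprD addnC.
Qed.

HB.instance Definition _ k :=
  GRing.isMonoidMorphism.Build G G (gphi k) (gphi_is_monoid_morphism k).

Lemma gphiK k : involutive (gphi k).
Proof.
elim/grassmann_ind=> [|x S a IH]; first by rewrite !raddf0.
rewrite !gphi_is_linear IH gphi_basis linearZ /= gphi_basis (scalerA (_ ^+ _)) -exprD addnn.
by rewrite -muln2 exprM sqrr_sign scale1r.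
Qed.

End Grassmann.

Local Open Scope classical_set_scope.
Local Open Scope ring_scope.

Section InducedGrading.
Context (F : fieldType) (A : lalgType F) (f : A -> A).

Definition even_component : set A := range (fun a => 2^-1 *: (a + f a)).
Definition odd_component : set A := range (fun a => 2^-1 *: (a - f a)).

End InducedGrading.

(* The variables X = Y \cup Z; [inl i] is y_{i+1} and [inr i] is z_{i+1}. *)
Definition variable := (nat + nat)%type.

(* F<X>: the algebra of the free monoid of words in X. *)
Notation free_alg F := {malg F[{fmonom variable}]}.

Section FreeAlgebra.
Context (F : fieldType).
Local Notation FX := (free_alg F).

Definition var (v : variable) : FX := << fmu v >>.
Definition yvar (i : nat) : FX := var (inl i).
Definition zvar (i : nat) : FX := var (inr i).

Definition odd_monomial (m : {fmonom variable}) : bool :=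
  odd (count (fun v : variable => if v is inr _ then true else false) m).

(* The degree-0 (b = false) and degree-1 (b = true) components of F<X>. *)
Definition homogeneous (b : bool) : set FX :=
  [set f | forall m, m \in msupp f -> odd_monomial m = b].

Definition subst (A : lalgType F) (s : variable -> A) : FX -> A :=
  lext (fun m : {fmonom variable} => \prod_(v <- m) s v).

Definition T2 (A : lalgType F) (A0 A1 : set A) : set FX :=
  [set f | forall s : variable -> A,
     (forall i, A0 (s (inl i))) -> (forall i, A1 (s (inr i))) ->
     subst s f = 0].

(* Stability under opposites and scalars follows from that under products. *)
Definition two_sided_ideal (I : set FX) : Prop :=
  [/\ I 0,
      forall f g, I f -> I g -> I (f + g)
    & forall f g, I f -> I (g * f) /\ I (f * g)].

Definition graded_endo (h : FX -> FX) : Prop :=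
  forall b f, homogeneous b f -> homogeneous b (h f).

Definition T2_ideal (I : set FX) : Prop :=
  two_sided_ideal I /\
  forall h : {lrmorphism FX -> FX}, graded_endo h ->
    forall f, I f -> I (h f).

Definition T2_ideal_generated (S : set FX) : set FX :=
  \bigcap_(I in [set I | T2_ideal I /\ S `<=` I]) I.

Definition commutator (f g : FX) : FX := f * g - g * f.

Definition I3_generators (p q k : nat) : set FX :=
  [set f | exists v1 v2 v3 : variable,
     f = commutator (commutator (var v1) (var v2)) (var v3)]
  `|` [set \prod_(i < k.+1) zvar i]
  `|` [set zvar 0 ^+ p]
  `|` [set yvar 0 ^+ (p * q) - yvar 0 ^+ p].

Definition I3 (p q k : nat) : set FX :=
  T2_ideal_generated (I3_generators p q k).

End FreeAlgebra.

(* Main.v *)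
From HB Require Import structures.
Require Import Defs.
From mathcomp Require Import all_boot all_order all_algebra all_field.
From mathcomp Require Import boolp classical_sets finmap monalg.
From mathcomp Require Import generic_quotient ring_quotient zify.

Set Implicit Arguments.
Unset Strict Implicit.
Unset Printing Implicit Defensive.

Import GRing.Theory.
Local Open Scope ring_scope.

(** Write I for the T_2-ideal on the right.  I is contained in T_2(G) because
    T_2(G) is itself a T_2-ideal and the generators vanish on G: commutators of
    basis elements are multiples of products of even length, hence central; an
    odd element is a combination of basis elements that each use one of the k
    negated generators, so k+1 of them multiply to 0; and the p-th power of an
    element is the p-th power of its scalar part (grassmann_exp_p), where
    x^q = x on F.

    For the converse, let R = F<X>/I.  Commutators are central in R, hence
    [a, b][c, d] = - [a, c][b, d], so a product of commutators is, up to sign,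
    a function of the set of its letters and vanishes on repeated letters.
    Sorting the letters of a word costs only such commutators, and R is spanned
    by the normal monomials
      x_1^(r_1) ... x_n^(r_n) [x_(j_1), x_(j_2)] [x_(j_3), x_(j_4)] ...
    with the j's distinct.  The exponents of the z's are below p.  A letter y is
    not nilpotent, but y^p is central and is fixed by the q-th power, so for
    every scalar a the element 1 - (y - a)^(p(q-1)) is central, is killed by
    (y - a)^p, and these elements add up to 1 when a runs over F.  Choosing a
    scalar a_i for each y_i and multiplying out, one decomposes 1 into central
    elements e_a, and on the part f e_a of f, the normal monomials may be taken
    in the letters y_i - a_i and z_i, with every exponent below p
    (indicator_spanned).

    Let f be in T_2(G), with f e_a = (sum_i c_i N_i) e_a in R.  At a point whose
    y-coordinates are a plus nilpotents, f vanishes and e_a becomes 1, so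
    sum_i c_i N_i vanishes at all nilpotent points.  This forces c = 0
    (lie_monomials_independent), so f e_a lies in I for every a, and f too.  For
    that last step take (r, J), exponents and set of commutator letters, with
    c_(r,J) <> 0, J of least cardinality and then r of least sum, and send each
    letter t to u_t + g_t: here u_t is a sum of r_t products of two generators,
    g_t is a generator if t is in J and 0 otherwise, no generator is used twice,
    and each occurrence of a letter z uses exactly one negated generator.  There
    are enough of these, since normal monomials with more than k letters z lie
    in I.  As [u_s + g_s, u_t + g_t] = 2 g_s g_t and u_t^(r_t + 1) = 0, every
    other term of the relation vanishes, and N_(r,J) becomes a nonzero multiple
    of a product of distinct generators. *)

(** * Products of commutators in rings whose commutators are central *)

(** Adjacent transpositions generate all permutations, so a property stable
    under them passes to every rearrangement. *)
Lemma perm_swap_ind (T : eqType) (P : seq T -> Prop) :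
  (forall s1 a b s2, P (s1 ++ [:: a, b & s2]) -> P (s1 ++ [:: b, a & s2])) ->
  forall s t, perm_eq s t -> P s -> P t.
Proof.
move=> swap.
have front s1 : forall r x s2, P (r ++ s1 ++ x :: s2) -> P (r ++ x :: s1 ++ s2).
  elim: s1 => [//|a s1 IH] r x s2; rewrite -[(a :: s1) ++ _]/([:: a] ++ _) catA.
  by move/IH; rewrite -catA => /swap.
suff main t : forall r s, perm_eq s t -> P (r ++ s) -> P (r ++ t).
  by move=> s t; apply: (main t [::]).
elim: t => [|x t IH] r s pst; first by move/perm_nilP: pst => ->.
have xs : x \in s by rewrite (perm_mem pst) mem_head.
case/splitPr: xs pst => s1 s2 pst /front.
rewrite -[x :: t]/([:: x] ++ t) -[x :: s1 ++ _]/([:: x] ++ _) !catA -catA.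
by apply: IH; rewrite -(perm_cons x) -(permPr pst) perm_sym perm_catC /= perm_cons perm_catC.
Qed.

Lemma size2_ind (T : Type) (P : seq T -> Prop) :
  P [::] -> (forall a, P [:: a]) -> (forall a b s, P s -> P [:: a, b & s]) ->
  forall s, P s.
Proof.
move=> P0 P1 P2 s; have [n] := ubnP (size s); elim: n s => // n IH [|a [|b s]] //= ltn.
by apply/P2/IH/ltnW.
Qed.

Definition lie (R : pzRingType) (a b : R) : R := a * b - b * a.

(** Consecutive entries are paired into commutators; a leftover entry gives 0, so
    that sequences of odd length need no separate treatment. *)
Fixpoint lie_prod (R : pzRingType) (s : seq R) : R :=
  match s with
  | [::] => 1
  | [:: _] => 0
  | a :: b :: s' => lie a b * lie_prod s'
  end.

Section Lie.
Context (R : pzRingType).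
Implicit Types (a b c d : R) (s : seq R).

Lemma lie_anti a b : lie b a = - lie a b.
Proof. by rewrite /lie opprB. Qed.

Lemma liexx a : lie a a = 0.
Proof. exact: subrr. Qed.

Lemma lie0P a b : lie a b = 0 <-> a * b = b * a.
Proof. by rewrite /lie; split=> [/subr0_eq|->]; rewrite ?subrr. Qed.

Lemma lieMr a b c : lie a (b * c) = lie a b * c + b * lie a c.
Proof. by rewrite /lie mulrBl mulrBr !mulrA subrKA. Qed.

Lemma lieMl a b c : lie (a * b) c = lie a c * b + a * lie b c.
Proof. by rewrite /lie mulrBl mulrBr !mulrA [RHS]addrC subrKA. Qed.

Lemma lieDl a b c : lie (a + b) c = lie a c + lie b c.
Proof. by rewrite /lie mulrDl mulrDr opprD addrACA. Qed.

Lemma lieDr a b c : lie c (a + b) = lie c a + lie c b.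
Proof. by rewrite /lie mulrDl mulrDr opprD addrACA. Qed.

Lemma lie_prod_odd s : odd (size s) -> lie_prod s = 0.
Proof. by elim/size2_ind: s => //= a b s IH; rewrite negbK => /IH ->; rewrite mulr0. Qed.

Hypothesis nil2 : forall a b c, lie (lie a b) c = 0.

Lemma lie_central a b c : lie a b * c = c * lie a b.
Proof. by apply/lie0P. Qed.

(** Expand [[a, bc], d] = 0 by the Leibniz rule: the terms with an iterated
    commutator vanish. *)
Lemma lie_exchange a b c d : lie a b * lie c d = - (lie a c * lie b d).
Proof.
have := nil2 a (b * c) d; rewrite lieMr lieDl !lieMl !nil2 mul0r add0r mulr0 addr0.
by move/eqP; rewrite addr_eq0 => /eqP ->; rewrite lie_central.
Qed.

(** Inside a pair this is the antisymmetry of the commutator; across two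
    neighbouring pairs it is lie_exchange. *)
Lemma lie_prod_swap s1 a b s2 :
  lie_prod (s1 ++ [:: b, a & s2]) = - lie_prod (s1 ++ [:: a, b & s2]).
Proof.
elim/size2_ind: s1 => [|c|c d s1 IH] /=; first by rewrite lie_anti mulNr.
- by case: s2 => [|d s2]; rewrite ?mulr0 ?oppr0 //= !mulrA lie_exchange mulNr.
- by rewrite IH mulrN.
Qed.

Lemma lie_prod_perm (T : eqType) (x : T -> R) (s t : seq T) : perm_eq s t ->
  exists b : bool, lie_prod (map x t) = (-1) ^+ b * lie_prod (map x s).
Proof.
move=> pst; pose P u := exists b : bool,
  lie_prod (map x u) = (-1) ^+ b * lie_prod (map x s).
apply: (@perm_swap_ind _ P _ s t pst); last by exists false; rewrite mul1r.
move=> s1 a b s2 [e eE]; exists (~~ e).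
rewrite map_cat /= lie_prod_swap -mulN1r -!map_cons -map_cat eE.
by case: e {eE}; rewrite !mulN1r ?mul1r ?opprK.
Qed.

(** Move the two equal letters to the front, where they form the pair [t, t]. *)
Lemma lie_prod_dup (T : eqType) (x : T -> R) (s : seq T) :
  ~~ uniq s -> lie_prod (map x s) = 0.
Proof.
case: s => [//|t0 s] /(uniqPn t0)[i [j [ij js e]]].
set u := t0 :: s in js e *; set a := nth t0 u i in e.
suff [v puv] : exists v, perm_eq [:: a, a & v] u.
  by have [b ->] := lie_prod_perm x puv; rewrite /= liexx mul0r mulr0.
have au : a \in u by rewrite mem_nth // (ltn_trans ij).
have : a \in rem a u; last first.
  by exists (rem a (rem a u)); rewrite perm_sym (permPl (perm_to_rem au)) perm_cons perm_to_rem.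
have c2 : (2 <= count_mem a u)%N.
  rewrite -(cat_take_drop j u) count_cat (drop_nth t0) //= -e eqxx addnA addn1 ltnS.
  rewrite ltn_addr // -has_count has_pred1.
  by rewrite /a -(@nth_take j) // mem_nth // size_take js.
by rewrite -has_pred1 has_count count_rem au /= eqxx subn_gt0.
Qed.

Lemma exp_lie n a b : a ^+ n * b = b * a ^+ n + (a ^+ n.-1 * lie a b) *+ n.
Proof.
elim: n => [|n IH]; first by rewrite !expr0 mulr0n addr0 mul1r mulr1.
have e: a * b = b * a + lie a b by rewrite addrC subrK.
rewrite exprSr -mulrA e mulrDr mulrA IH mulrDl -mulrA -exprSr /= -addrA mulrS.
congr (_ + _); rewrite [RHS]addrC; congr (_ + _).
rewrite mulrnAl -mulrA lie_central mulrA; case: n {IH} => [|n] //=.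
by rewrite -exprSr.
Qed.

End Lie.

(** The normal monomials: the first component holds the exponents, the second the
    set of letters entering the commutators. *)
Definition lie_monomial (R : pzRingType) (T : finType) (x : T -> R) (p : nat)
    (i : {ffun T -> 'I_p} * {set T}) : R :=
  (\prod_t x t ^+ i.1 t) * lie_prod [seq x t | t <- enum i.2].

Section Spanning.
Context (R : pzRingType) (T : finType) (x : T -> R) (p : nat) (E : R).
Hypothesis nil2 : forall a b c : R, lie (lie a b) c = 0.
Hypothesis centralE : forall a : R, E * a = a * E.
Hypothesis exp_xE : forall t, x t ^+ p * E = 0.

Let spanned (a : R) := exists c : {ffun T -> 'I_p} * {set T} -> int,
  a * E = (\sum_i lie_monomial x i *~ c i) * E.

Let spanned0 a : a * E = 0 -> spanned a.
Proof.
by exists (fun=> 0) => //; rewrite big1 ?mul0r.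
Qed.

Let spannedD a b : spanned a -> spanned b -> spanned (a + b).
Proof.
move=> [c cE] [d dE]; exists (fun i => c i + d i).
rewrite mulrDl cE dE -mulrDl -big_split /=; congr (_ * E).
by apply: eq_bigr => i _; rewrite mulrzDr.
Qed.

Let spannedN a : spanned a -> spanned (- a).
Proof.
move=> [c cE]; exists (fun i => - c i).
rewrite mulNr cE -mulNr -sumrN; congr (_ * E).
by apply: eq_bigr => i _; rewrite mulrNz.
Qed.

Let spanned_monomial (i : {ffun T -> 'I_p} * {set T}) : spanned (lie_monomial x i).
Proof.
exists (fun j => (j == i)%:Z); congr (_ * E).
rewrite (bigD1 i) //= eqxx mulr1z big1 ?addr0 // => j /negPf ->.
by rewrite mulr0z.
Qed.

Lemma prod_annihilate (r : seq T) (f : T -> R) t :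
  t \in r -> f t * E = 0 -> (\prod_(u <- r) f u) * E = 0.
Proof.
move=> tr ftE; case/splitPr: tr => r1 r2.
by rewrite big_cat big_cons -!mulrA -centralE (mulrA (f t)) ftE mul0r mulr0.
Qed.

Let spanned_powers (m : T -> nat) s :
  spanned ((\prod_t x t ^+ m t) * lie_prod [seq x t | t <- s]).
Proof.
have [/forallP ltm|] := boolP [forall t, (m t < p)%N]; last first.
  case/forallPn => t; rewrite -leqNgt => lepm; apply: spanned0.
  rewrite -mulrA -centralE mulrA (@prod_annihilate _ _ t) ?mul0r ?mem_index_enum //.
  by rewrite -(subnK lepm) exprD -mulrA exp_xE mulr0.
have [us|nus] := boolP (uniq s); last first.
  by apply: spanned0; rewrite (lie_prod_dup nil2) // mulr0 mul0r.
have ps : perm_eq (enum [set t in s]) s.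
  by apply: uniq_perm => // [|t]; rewrite ?enum_uniq // mem_enum inE.
have [b ->] := lie_prod_perm nil2 x ps.
have := spanned_monomial ([ffun t => Ordinal (ltm t)], [set t in s]).
rewrite /lie_monomial /=; under eq_bigr => t _ do rewrite ffunE /=.
by case: b => Sp; rewrite ?mulN1r ?mul1r ?mulrN //; apply: spannedN.
Qed.

Let sort_letters (l : seq T) :
  perm_eq (flatten [seq nseq (count_mem t l) t | t <- index_enum T]) l.
Proof.
apply/allP => u _ /=; rewrite count_flatten sumnE !big_map.
rewrite (bigD1 u) //= count_nseq /= eqxx mul1n big1 ?addn0 // => t /negPf tu.
by rewrite count_nseq /= tu.
Qed.

(** Swapping two neighbouring letters of a word changes it by a shorter word times
    a commutator, so by induction on the length every word may be sorted.  Powers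
    with exponent at least p are then killed by E, and the commutator part
    depends only on its set of letters up to sign.  Integer coefficients are
    enough, which keeps the statement independent of any base field. *)
Lemma word_spanned (l : seq T) :
  exists c : {ffun T -> 'I_p} * {set T} -> int,
  (\prod_(t <- l) x t) * E = (\sum_i lie_monomial x i *~ c i) * E.
Proof.
suff main n : forall l s, size l = n ->
    spanned ((\prod_(t <- l) x t) * lie_prod [seq x t | t <- s]).
  by have := main _ l [::] erefl; rewrite mulr1.
elim/ltn_ind: n => n IH {}l s sl.
(* The length is carried along so that the induction hypothesis applies after a swap. *)
pose P u := size u = n /\ spanned ((\prod_(t <- u) x t) * lie_prod [seq x t | t <- s]).
suff [] : P l by [].
apply: (@perm_swap_ind _ P _ _ l (sort_letters l)).
  move=> s1 a b s2 [sz Sp]; split; first by rewrite -sz !size_cat.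
  have sz' : size (s1 ++ s2) = n.-2 by rewrite -sz !size_cat /= !addnS.
  have ltn2 : (n.-2 < n)%N by rewrite -sz size_cat /= !addnS.
  have := spannedD Sp (spannedN (IH _ ltn2 _ [:: a, b & s] sz')).
  congr spanned; rewrite !big_cat !big_cons /=.
  set A := \big[_/_]_(_ <- s1) _; set B := \big[_/_]_(_ <- s2) _.
  have -> : A * B * (lie (x a) (x b) * lie_prod [seq x t | t <- s])
      = A * (lie (x a) (x b) * B) * lie_prod [seq x t | t <- s].
    by rewrite (lie_central nil2 _ _ B) !mulrA.
  rewrite -mulrBl -mulrBr; congr (_ * _ * _).
  by rewrite /lie mulrBl !mulrA opprB addrC subrK.
split; first by rewrite (perm_size (sort_letters l)).
have := spanned_powers (fun t => count_mem t l) s; congr (spanned (_ * _)).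
rewrite big_flatten big_map; apply: eq_bigr => t _.
by rewrite big_nseq; elim: (count_mem t l) => [|k IHk] //=; rewrite exprS IHk.
Qed.

End Spanning.

(** * The quotient of a ring by a two-sided ideal *)

Section TwoSidedQuotient.
Context (A : pzRingType) (I : A -> Prop).
Hypothesis I0 : I 0.
Hypothesis ID : forall a b, I a -> I b -> I (a + b).
Hypothesis IM : forall a b, I a -> I (b * a) /\ I (a * b).

Let mem_ideal : {pred A} := fun a => `[< I a >].

Let mem_idealE a : (a \in mem_ideal) = `[< I a >].
Proof. by []. Qed.

Let mem_ideal_zmod : zmod_closed mem_ideal.
Proof.
split=> [|a b]; rewrite !mem_idealE; first exact/asboolP.
move=> /asboolP Ia /asboolP Ib; apply/asboolP/ID => //.
by rewrite -mulN1r; case: (IM (-1) Ib).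
Qed.

Let mem_ideal_build := GRing.isZmodClosed.Build A mem_ideal mem_ideal_zmod.
Let J : zmodClosed A := HB.pack mem_ideal mem_ideal_build.
Local Notation Q := (Quotient.quot J).
Local Notation pi := (\pi_Q)%qT.
Let one : Q := pi 1.
Let mul (x y : Q) : Q := pi (repr x * repr y).

Let piP a b : pi a = pi b <-> I (a - b).
Proof.
split=> [/eqP|Iab]; first by rewrite -Quotient.idealrBE mem_idealE => /asboolP.
by apply/eqP; rewrite -Quotient.idealrBE mem_idealE; apply/asboolP.
Qed.

Let piM a b : mul (pi a) (pi b) = pi (a * b).
Proof.
apply/esym/piP; set c := repr _; set d := repr _.
have Iac : I (a - c) by apply/piP; rewrite /c reprK.
have Ibd : I (b - d) by apply/piP; rewrite /d reprK.
have -> : a * b - c * d = (a - c) * b + c * (b - d).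
  by rewrite mulrBl mulrBr subrKA.
apply: ID; first exact: (IM b Iac).2.
exact: (IM c Ibd).1.
Qed.

Let pi_surj (x : Q) : exists a, x = pi a.
Proof. by exists (repr x); rewrite reprK. Qed.

Let mulA : associative mul.
Proof.
move=> x y z; have [a ->] := pi_surj x; have [b ->] := pi_surj y.
have [c ->] := pi_surj z; rewrite !piM mulrA; reflexivity.
Qed.

Let mul1 : left_id one mul.
Proof. move=> x; have [a ->] := pi_surj x; rewrite piM mul1r; reflexivity. Qed.

Let mul1r' : right_id one mul.
Proof. move=> x; have [a ->] := pi_surj x; rewrite piM mulr1; reflexivity. Qed.

Let piD a b : pi a + pi b = pi (a + b).
Proof. by rewrite !piE. Qed.

Let mulDl : left_distributive mul +%R.
Proof.
move=> x y z; have [a ->] := pi_surj x; have [b ->] := pi_surj y.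
have [c ->] := pi_surj z; rewrite !(piM, piD) mulrDl; reflexivity.
Qed.

Let mulDr : right_distributive mul +%R.
Proof.
move=> x y z; have [a ->] := pi_surj x; have [b ->] := pi_surj y.
have [c ->] := pi_surj z; rewrite !(piM, piD) mulrDr; reflexivity.
Qed.

(** Stated as an existence, so that later arguments see only an abstract ring and
    never unfold the representatives. *)
Lemma two_sided_quotient : exists (B : pzRingType) (f : {rmorphism A -> B}),
  (forall a, f a = 0 <-> I a) /\ (forall b, exists a, b = f a).
Proof.
pose ringQ := GRing.Zmodule_isPzRing.Build Q mulA mul1 mul1r' mulDl mulDr.
pose B : pzRingType := HB.pack Q ringQ.
pose f (a : A) : B := pi a.
have fD : zmod_morphism f by move=> a b; rewrite /f !piE.
have fM : monoid_morphism f by split=> // a b; apply/esym/piM.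
pose f_add := GRing.isZmodMorphism.Build A B f fD.
pose f_mul := GRing.isMonoidMorphism.Build A B f fM.
pose g : {rmorphism A -> B} := HB.pack f f_add f_mul.
exists B, g; split=> [a|b] /=.
  have f0 : f 0 = 0 := raddf0 g.
  by rewrite -f0 -[X in I X]subr0; apply: piP.
exact: pi_surj.
Qed.

End TwoSidedQuotient.

(** * Identities of the Grassmann algebra *)

(** Move all occurrences of o to the left: two of them cancel by the sandwich
    relation, and moving one past a^i costs i a^(i-1) [a, o].  For n = p both
    correction terms are multiples of p. *)
Lemma expr_add_sandwich (R : pzRingType) (a o : R) n :
    (forall x y z : R, lie (lie x y) z = 0) -> (forall b, o * b * o = 0) ->
  (a + o) ^+ n =
    a ^+ n + (o * a ^+ n.-1) *+ n + (a ^+ n.-2 * lie a o) *+ 'C(n, 2).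
Proof.
move=> nil2 sandwich; have oo : o * o = 0 by rewrite -{1}[o]mulr1 sandwich.
elim: n => [|n IH]; first by rewrite !expr0 !mulr0n !addr0.
have lieo : lie a o * o = 0.
  by rewrite /lie mulrBl -mulrA oo mulr0 sandwich subrr.
(* The predecessor in the exponent is harmless: its coefficient is 0 when m = 0. *)
have shift (x : R) m k : x * a ^+ m.-1 * a *+ (m * k) = x * a ^+ m *+ (m * k).
  by case: m => [|m] //=; rewrite -mulrA -exprSr.
rewrite exprSr IH mulrDr !mulrDl !mulrnAl -exprSr sandwich mul0rn addr0.
rewrite -(mulrA _ (lie a o) o) lieo mulr0 mul0rn addr0 (exp_lie nil2 n a o).
have -> : o * a ^+ n.-1 * a *+ n = o * a ^+ n *+ n.
  by have := shift o n 1%N; rewrite muln1.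
rewrite -mulrA (lie_central nil2) mulrA.
have -> : a ^+ n.-2 * a * lie a o *+ 'C(n, 2) = a ^+ n.-1 * lie a o *+ 'C(n, 2).
  by case: n {IH} => [|[|n]] //=; rewrite -exprSr.
rewrite binS bin1 mulrnDr mulrS -!addrA; congr (_ + _).
by rewrite ![_ + (o * _ + _)]addrCA; congr (_ + _); rewrite addrCA.
Qed.

Section GrassmannIdentities.
Context (F : fieldType).
Local Notation G := (grassmann F).
Local Notation gbasis := (gbasis F).
Implicit Types (S T U : {fset nat}) (a b c : G).

Lemma inversions_sum S T : [disjoint S & T]%fset ->
  (inversions S T + inversions T S = #|` S| * #|` T|)%N.
Proof.
move=> /fdisjointP dST; rewrite /inversions exchange_big /= -big_split /=.
rewrite -[#|` T|]sum1_size big_distrr /= !big_seq; apply: eq_bigr => j jT.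
rewrite -big_split /= -[#|` S|]sum1_size muln1 !big_seq; apply: eq_bigr => i iS.
by case: ltngtP => // ij; move: (dST i iS); rewrite -ij jT.
Qed.

Lemma gbasisC S T :
  gbasis S * gbasis T = (-1) ^+ (#|` S| * #|` T|) *: (gbasis T * gbasis S).
Proof.
rewrite !gbasisM /gmul_basis fdisjoint_sym.
case: ifP => dTS; last by rewrite scaler0.
rewrite scalerA fsetUC -inversions_sum 1?fdisjoint_sym // exprD -mulrA -exprD.
by rewrite addnn -muln2 exprM sqrr_sign mulr1.
Qed.

Lemma gbasis_sandwich S a : S != fset0 -> gbasis S * a * gbasis S = 0.
Proof.
move=> S0; elim/grassmann_ind: a => [|x T a IH]; first by rewrite mulr0 mul0r.
rewrite mulrDr mulrDl IH addr0 -scalerAr -scalerAl gbasisC -scalerAl -mulrA.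
rewrite [gbasis S * _]gbasisM /gmul_basis ifN ?mulr0 ?scaler0 //.
by rewrite -fsetI_eq0 fsetIid.
Qed.

Lemma gbasis_even_central S a : ~~ odd #|` S| -> gbasis S * a = a * gbasis S.
Proof.
move=> evS; elim/grassmann_ind: a => [|x T a IH]; first by rewrite mulr0 mul0r.
rewrite mulrDr mulrDl IH -scalerAr -scalerAl gbasisC.
by rewrite -signr_odd oddM (negPf evS) scale1r.
Qed.

Lemma lieZl (A : algType F) x (a b : A) : lie (x *: a) b = x *: lie a b.
Proof. by rewrite /lie -scalerAl -scalerAr scalerBr. Qed.

Lemma lieZr (A : algType F) x (a b : A) : lie a (x *: b) = x *: lie a b.
Proof. by rewrite /lie -scalerAl -scalerAr scalerBr. Qed.

Lemma lie0l (R : pzRingType) (a : R) : lie 0 a = 0.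
Proof. by rewrite /lie mul0r mulr0 subrr. Qed.

Lemma lie0r (R : pzRingType) (a : R) : lie a 0 = 0.
Proof. by rewrite /lie mul0r mulr0 subrr. Qed.

(** By linearity on basis elements, where a nonzero commutator has two odd factors
    and is therefore a multiple of an even, hence central, basis element. *)
Lemma grassmann_lie_lie a b c : lie (lie a b) c = 0.
Proof.
elim/grassmann_ind: a => [|x S a IHa]; first by rewrite !lie0l.
rewrite (lieDl (x *: gbasis S) a b) lieDl IHa addr0 !lieZl.
apply/eqP; rewrite scaler_eq0; apply/orP; right.
apply/eqP; elim/grassmann_ind: b {IHa} => [|y T b IHb]; first by rewrite lie0r lie0l.
rewrite lieDr lieDl IHb addr0 lieZr lieZl [X in _ *: X](_ : _ = 0) ?scaler0 //.
apply/lie0P; rewrite /lie [gbasis T * _]gbasisC -signr_odd oddM gbasisM /gmul_basis.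
case: ifP => dST; last by rewrite scaler0 subrr mul0r mulr0.
case oS: (odd #|` S|); last by rewrite andbF scale1r subrr mul0r mulr0.
case oT: (odd #|` T|); last by rewrite scale1r subrr mul0r mulr0.
rewrite scaleN1r opprK mulrDl mulrDr -!scalerAl -!scalerAr gbasis_even_central //.
by rewrite cardfsU (eqP (_ : (S `&` T)%fset == fset0)) ?fsetI_eq0 // cardfs0 subn0 oddD oS oT.
Qed.

(** The span of the basis elements indexed by P, as an inductive predicate because
    its induction principle is the only thing used about it. *)
Inductive gspan (P : pred {fset nat}) : G -> Prop :=
  | gspan0 : gspan P 0
  | gspanD x S a : P S -> gspan P a -> gspan P (x *: gbasis S + a).

Lemma gspan_basis (P : pred {fset nat}) S : P S -> gspan P (gbasis S).
Proof.
move=> PS; rewrite -[gbasis S]addr0 -[gbasis S]scale1r.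
by apply: gspanD => //; exact: gspan0.
Qed.

Lemma gspan_add (P : pred {fset nat}) a b : gspan P a -> gspan P b -> gspan P (a + b).
Proof.
move=> Pa Pb; elim: Pa => [|x S {}a PS _ IH]; first by rewrite add0r.
by rewrite -addrA; apply: gspanD.
Qed.

Lemma gspan_scale (P : pred {fset nat}) x a : gspan P a -> gspan P (x *: a).
Proof.
elim=> [|y S {}a PS _ IH]; first by rewrite scaler0; exact: gspan0.
by rewrite scalerDr scalerA; apply: gspanD.
Qed.

Lemma gspan_sub (P Q : pred {fset nat}) a :
  (forall S, P S -> Q S) -> gspan P a -> gspan Q a.
Proof. by move=> PQ; elim=> [|x S b /PQ QS _ IH]; [exact: gspan0 | apply: gspanD]. Qed.

Lemma gspan_sum (P : pred {fset nat}) (I : Type) (r : seq I) (Q : pred I) (f : I -> G) :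
  (forall i, Q i -> gspan P (f i)) -> gspan P (\sum_(i <- r | Q i) f i).
Proof. by move=> Pf; apply: big_ind => //; [exact: gspan0 | exact: gspan_add]. Qed.

Lemma gspan_mul (P Q PQ : pred {fset nat}) a b :
    (forall S T, P S -> Q T -> [disjoint S & T]%fset -> PQ (S `|` T)%fset) ->
  gspan P a -> gspan Q b -> gspan PQ (a * b).
Proof.
move=> hPQ Pa Qb; elim: Pa => [|x S {}a PS _ IH].
  by rewrite mul0r; exact: gspan0.
rewrite mulrDl; apply: gspan_add => {IH}//; rewrite -scalerAl; apply: gspan_scale.
elim: Qb => [|y T {}b QT _ IH]; first by rewrite mulr0; exact: gspan0.
rewrite mulrDr; apply: gspan_add => //; rewrite -scalerAr; apply: gspan_scale.
rewrite gbasisM /gmul_basis; case: ifP => dST; last exact: gspan0.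
by apply/gspan_scale/gspan_basis/hPQ.
Qed.

Lemma gspan_pred0 (P : pred {fset nat}) a : P =1 pred0 -> gspan P a -> a = 0.
Proof. by move=> P0; case=> // x S b; rewrite P0. Qed.

Section Components.
Context (k : nat).
Hypothesis two_neq0 : 2%:R != 0 :> F.
Local Notation weight := (fun S : {fset nat} => \sum_(i <- S) (i < k))%N.

Let half a : 2^-1 *: (a + a) = a.
Proof. by rewrite -mulr2n -scaler_nat scalerA mulVf ?scale1r. Qed.

Lemma even_componentP a : even_component (@gphi F k) a <-> gphi k a = a.
Proof.
split=> [[b _ <-]|phi_a]; last by exists a; rewrite // phi_a half.
by rewrite linearZ linearD /= gphiK addrC.
Qed.

Lemma odd_componentP a : odd_component (@gphi F k) a <-> gphi k a = - a.
Proof.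
split=> [[b _ <-]|phi_a]; last by exists a; rewrite // phi_a opprK half.
by rewrite linearZ linearB /= gphiK -scalerN opprB.
Qed.

Lemma odd_component_gspan a :
  odd_component (@gphi F k) a -> gspan (fun S => 0 < weight S)%N a.
Proof.
case=> b _ <-; apply: gspan_scale; elim/grassmann_ind: b => [|x S b IH].
  by rewrite raddf0 subr0; exact: gspan0.
rewrite linearD linearZ /= gphi_basis opprD addrACA; apply: gspan_add => //.
rewrite -scalerBr; apply: gspan_scale; have [->|wS] := posnP (\sum_(i <- S) (i < k))%N.
  by rewrite scale1r subrr; exact: gspan0.
by apply: gspan_add; [|rewrite -scaleN1r; do 2 apply: gspan_scale]; apply: gspan_basis.
Qed.

Lemma weight_le S : (weight S <= k)%N.
Proof.
have -> : weight S = size [seq i <- S | (i < k)%N].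
  by rewrite size_filter -sum1_count [RHS]big_mkcond; apply: eq_bigr => i _; case: ltnP.
rewrite -[leqRHS](size_iota 0 k); apply: uniq_leq_size; first by rewrite filter_uniq ?fset_uniq.
by move=> i; rewrite mem_filter mem_iota => /andP[].
Qed.

(** Each factor contributes at least one of the k negated generators to every basis
    element in its support, and a basis element contains each generator once. *)
Lemma odd_component_prod (z : nat -> G) :
  (forall i, odd_component (@gphi F k) (z i)) -> \prod_(i < k.+1) z i = 0.
Proof.
move=> oz; suff gz m : gspan (fun S => m <= weight S)%N (\prod_(i < m) z i).
  apply: gspan_pred0 (gz _) => S; apply/negbTE.
  by rewrite -ltnNge ltnS weight_le.
elim: m => [|m IH].
  by rewrite big_ord0 -gbasis0; apply: gspan_basis.
rewrite big_ord_recr /=; apply: gspan_mul IH (odd_component_gspan (oz m)).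
by move=> S T wS wT dST; rewrite sum_fsetU // -addn1 leq_add.
Qed.

End Components.

Section FrobeniusPower.
Context (p : nat).
Hypotheses (char_F : p \in [pchar F]) (p_gt2 : (2 < p)%N).

Lemma pchar_grassmann : p \in [pchar G].
Proof. by rewrite pchar_lalg. Qed.

(** A basis element of positive degree satisfies the sandwich relation whatever its
    parity, so each step of the sum adds only multiples of p. *)
Lemma gspan_exp_p a : gspan (fun S => S != fset0) a -> a ^+ p = 0.
Proof.
have p0 : (0 < p)%N by case: (p) p_gt2.
elim=> [|x S {}a S0 _ IH]; first by rewrite expr0n; case: (p) p0.
have sandwich b : (x *: gbasis S) * b * (x *: gbasis S) = 0.
  by rewrite -!scalerAl -scalerAr gbasis_sandwich // !scaler0.
rewrite addrC (expr_add_sandwich _ _ (@grassmann_lie_lie) sandwich) IH add0r.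
rewrite mulrn_pchar ?pchar_grassmann // add0r.
have /dvdnP[m ->] : (p %| 'C(p, 2))%N.
  by rewrite prime_dvd_bin ?(pcharf_prime char_F).
by rewrite mulrnA mulrn_pchar ?pchar_grassmann.
Qed.

Lemma grassmann_augmentation a :
  exists x b, a = x%:A + b /\ gspan (fun S => S != fset0) b.
Proof.
elim/grassmann_ind: a => [|y S a [x [b [-> gb]]]].
  by exists 0, 0; rewrite scale0r addr0; split; last exact: gspan0.
have [->|S0] := eqVneq S fset0.
  by exists (y + x), b; rewrite scalerDl addrA.
by exists x, (y *: gbasis S + b); rewrite addrCA; split=> //; apply: gspanD.
Qed.

Lemma grassmann_exp_p a : exists x : F, a ^+ p = (x ^+ p)%:A.
Proof.
have [x [b [-> gb]]] := grassmann_augmentation a; exists x.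
rewrite -!(pFrobenius_autE pchar_grassmann) pFrobenius_autD_comm; last first.
  by rewrite /GRing.comm -scalerAl -scalerAr mul1r mulr1.
rewrite !pFrobenius_autE (gspan_exp_p gb) addr0 -[_%:A ^+ p]/((in_alg G x) ^+ p).
by rewrite -rmorphXn.
Qed.

End FrobeniusPower.

End GrassmannIdentities.

(** * Words, substitutions and degrees in the free algebra *)

Section FreeAlgebraTheory.
Context (F : fieldType).
Local Notation FX := (free_alg F).
Local Notation var := (@var F).
Implicit Types (f g : FX) (w : seq variable).

Definition word w : FX := \prod_(v <- w) var v.

Lemma monomM (m1 m2 : {fmonom variable}) :
  << m1 >> * << m2 >> = << fmmul m1 m2 >> :> FX.
Proof. by rewrite malgM_def fgmulUU mulr1. Qed.

Lemma wordE w : word w = << FMonom w >>.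
Proof.
elim: w => [|v w IH]; first by rewrite /word big_nil -fmoneE.
by rewrite /word big_cons -/(word w) IH monomM fmmulE fmuE.
Qed.

Lemma word_cat w1 w2 : word (w1 ++ w2) = word w1 * word w2.
Proof. exact: big_cat. Qed.

Lemma monomE (m : {fmonom variable}) : << m >> = word m.
Proof. by rewrite wordE fmK. Qed.

Lemma free_alg_ind (P : FX -> Prop) :
  P 0 -> (forall c w f, P f -> P (c *: word w + f)) -> forall f, P f.
Proof. by move=> P0 PD; apply: malg_ind => // c m f; rewrite monomE; exact: PD. Qed.

Lemma scale_word c w : c *: word w = << c *g FMonom w >>.
Proof.
rewrite wordE; apply/malgP => m; etransitivity; first exact: mcoeffZ.
by rewrite !mcoeffU mulr_natr.
Qed.

Lemma free_scalerAr (c : F) f g : c *: (f * g) = f * (c *: g).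
Proof.
apply/malgP => m.
rewrite [RHS](@mcoeffMlw _ _ (msupp f) (msupp g) f (c *: g)) //; last exact: msuppZ_le.
etransitivity; [exact: mcoeffZ | rewrite (mcoeffMl f g)].
rewrite big_distrr; apply: eq_bigr => m1 _; rewrite /= big_distrr.
by apply: eq_bigr => m2 _; rewrite (mcoeffZ c g m2) /= mulrnAr mulrCA.
Qed.

End FreeAlgebraTheory.

(** Multiplicativity of a linear map need only be tested on a spanning set W; the
    spanning property enters as an induction principle. *)
Lemma linear_multiplicative (F : fieldType) (A B : lalgType F)
    (h : {linear A -> B}) (W : A -> Prop) :
    (forall c (a b : A), c *: (a * b) = a * (c *: b)) ->
    (forall c (a b : B), c *: (a * b) = a * (c *: b)) ->
    (forall P : A -> Prop, P 0 ->
      (forall c w a, W w -> P a -> P (c *: w + a)) -> forall a, P a) ->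
    (forall u v, W u -> W v -> h (u * v) = h u * h v) ->
  forall a b, h (a * b) = h a * h b.
Proof.
move=> ZrA ZrB ind hW a b; elim/ind: a => [|c u a Wu IHa].
  by rewrite mul0r raddf0 mul0r.
rewrite mulrDl -scalerAl !linearP mulrDl -scalerAl IHa; congr (_ *: _ + _).
elim/ind: b {IHa} => [|d v b Wv IHb]; first by rewrite mulr0 raddf0 mulr0.
by rewrite mulrDr -ZrA !linearP mulrDr -ZrB IHb hW.
Qed.

Section Substitution.
Context (F : fieldType).
Local Notation FX := (free_alg F).

HB.instance Definition _ (A : lalgType F) (s : variable -> A) :=
  GRing.isLinear.Build F FX A *:%R (subst s) (lext_is_linear _).

Lemma subst_word (A : lalgType F) (s : variable -> A) w :
  subst s (word F w) = \prod_(v <- w) s v.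
Proof. by rewrite /subst wordE lextU. Qed.

Lemma subst_var (A : lalgType F) (s : variable -> A) v : subst s (var F v) = s v.
Proof. by rewrite /subst /var lextU fmuE big_seq1. Qed.

Lemma subst_multiplicative (A : lalgType F) (s : variable -> A) :
    (forall c (a b : A), c *: (a * b) = a * (c *: b)) ->
  monoid_morphism (subst s).
Proof.
move=> ZrA; split; first by have := subst_word s [::]; rewrite /word !big_nil.
apply: (@linear_multiplicative F FX A (subst s) (fun f => exists w, f = word F w)).
- exact: free_scalerAr.
- exact: ZrA.
- by move=> P P0 PD; apply: free_alg_ind => // c w f; apply: PD; exists w.
move=> _ _ [w1 ->] [w2 ->]; have := subst_word s (w1 ++ w2).
by rewrite word_cat big_cat => /= ->; congr (_ * _); apply/esym/subst_word.
Qed.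

HB.instance Definition _ (A : algType F) (s : variable -> A) :=
  GRing.isMonoidMorphism.Build FX A (subst s)
    (subst_multiplicative s (@scalerAr F A)).

(** Substitutions into the free algebra itself; scalars are central there by
    free_scalerAr, which makes them algebra endomorphisms. *)
Definition free_endo (s : variable -> FX) : FX -> FX := subst s.

HB.instance Definition _ s := GRing.Linear.on (free_endo s).
HB.instance Definition _ s :=
  GRing.isMonoidMorphism.Build FX FX (free_endo s)
    (subst_multiplicative s (@free_scalerAr F)).

End Substitution.

Lemma eq_free_morphism (F : fieldType) (A : lalgType F)
    (g h : {lrmorphism free_alg F -> A}) :
  (forall v, g (var F v) = h (var F v)) -> g =1 h.
Proof.
move=> gh; apply: free_alg_ind => [|c w f IH]; first by rewrite (raddf0 g) (raddf0 h).
transitivity (c *: g (word F w) + g f); first exact: linearP.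
transitivity (c *: h (word F w) + h f); last exact/esym/linearP.
rewrite IH; congr (_ *: _ + _); rewrite /word.
transitivity (\prod_(v <- w) g (var F v)); first exact: rmorph_prod.
transitivity (\prod_(v <- w) h (var F v)); last exact/esym/rmorph_prod.
exact: eq_bigr.
Qed.

Section Grading.
Context (F : fieldType).
Local Notation FX := (free_alg F).
Implicit Types (f g : FX) (w : seq variable).

Definition is_z (v : variable) : bool := if v is inr _ then true else false.

Lemma homogeneous0 b : homogeneous b (0 : FX).
Proof. by move=> m; rewrite msupp0 inE. Qed.

Lemma homogeneousD b f g : homogeneous b f -> homogeneous b g -> homogeneous b (f + g).
Proof.
move=> hf hg m /(fsubsetP (msuppD_le _ _)); rewrite inE.
by case/orP; [exact: hf | exact: hg].
Qed.

Lemma homogeneousZ b c f : homogeneous b f -> homogeneous b (c *: f).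
Proof. by move=> hf m /(fsubsetP (msuppZ_le _ _)); exact: hf. Qed.

Lemma homogeneousM b c f g :
  homogeneous b f -> homogeneous c g -> homogeneous (b (+) c) (f * g).
Proof.
move=> hf hg m /msuppM_le[m1 [m2 [m1f m2g ->]]].
rewrite -(hf _ m1f) -(hg _ m2g) /odd_monomial [mmul _ _]fmmulE /=.
by rewrite count_cat oddD.
Qed.

Lemma homogeneous_word w : homogeneous (odd (count is_z w)) (word F w).
Proof. by move=> m; rewrite wordE msuppU1 inE => /eqP ->. Qed.

Lemma homogeneous_var v : homogeneous (is_z v) (var F v).
Proof.
by have := @homogeneous_word [:: v]; rewrite /word big_seq1 /= addn0 oddb.
Qed.

(** Gr is any grading of the target by Z/2, used both for the free algebra and for
    the eigenspaces of the automorphism of the Grassmann algebra. *)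
Lemma homogeneous_subst (A : lalgType F) (Gr : bool -> A -> Prop) (s : variable -> A) :
    (forall b, Gr b 0) ->
    (forall b c x y, Gr b x -> Gr b y -> Gr b (c *: x + y)) ->
    Gr false 1 ->
    (forall b c x y, Gr b x -> Gr c y -> Gr (b (+) c) (x * y)) ->
    (forall v, Gr (is_z v) (s v)) ->
  forall b f, homogeneous b f -> Gr b (subst s f).
Proof.
move=> Gr0 GrD Gr1 GrM Grs b f hf; rewrite /subst lextE big_seq.
apply: big_ind => // [x y Gx Gy|m mf]; first by rewrite -[x]scale1r; apply: GrD.
rewrite -[_ *: _]addr0; apply: GrD => //; rewrite -(hf m mf) /odd_monomial.
elim: (fmonom_val m) => [|v w IH]; first by rewrite big_nil.
by rewrite big_cons /= oddD oddb; apply: GrM => //; exact: Grs.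
Qed.

Lemma graded_free_endo (s : variable -> FX) :
  (forall v, homogeneous (is_z v) (s v)) -> graded_endo (free_endo s).
Proof.
move=> hs; apply: homogeneous_subst => //.
- exact: homogeneous0.
- by move=> b c f g hf; apply: homogeneousD; apply: homogeneousZ.
- by have := @homogeneous_word [::]; rewrite /word big_nil.
- exact: homogeneousM.
Qed.

End Grading.

(** * The generators are graded identities of the Grassmann algebra *)

Lemma rmorph_lie (A B : pzRingType) (h : {rmorphism A -> B}) a b :
  h (lie a b) = lie (h a) (h b).
Proof. by rewrite rmorphB !rmorphM. Qed.

Lemma rmorph_lie_prod (A B : pzRingType) (h : {rmorphism A -> B}) s :
  h (lie_prod s) = lie_prod (map h s).
Proof.
elim/size2_ind: s => [|a|a b s IH] /=; first exact: rmorph1; first exact: rmorph0.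
by rewrite rmorphM rmorph_lie IH.
Qed.

Lemma rmorph_lie_monomial (A B : pzRingType) (h : {rmorphism A -> B})
    (T : finType) (x : T -> A) p (i : {ffun T -> 'I_p} * {set T}) :
  h (lie_monomial x i) = lie_monomial (h \o x) i.
Proof.
rewrite rmorphM rmorph_prod rmorph_lie_prod -map_comp; congr (_ * _).
by apply: eq_bigr => t _; rewrite rmorphXn.
Qed.

Section SoundnessT2.
Context (F : fieldType) (k : nat).
Hypothesis two_neq0 : 2%:R != 0 :> F.
Local Notation G := (grassmann F).
Local Notation G0 := (even_component (@gphi F k)).
Local Notation G1 := (odd_component (@gphi F k)).
Local Notation FX := (free_alg F).

Definition admissible (s : variable -> G) : Prop :=
  (forall i, G0 (s (inl i))) /\ (forall i, G1 (s (inr i))).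

Let Gr (b : bool) (a : G) : Prop := gphi k a = (-1) ^+ b *: a.

Lemma homogeneous_subst_grassmann s b (f : FX) :
  admissible s -> homogeneous b f -> gphi k (subst s f) = (-1) ^+ b *: subst s f.
Proof.
case=> evs ods; move: b f; apply: (@homogeneous_subst F G Gr) => //.
- by move=> b; rewrite /Gr raddf0 scaler0.
- by move=> b c x y Gx Gy; rewrite /Gr linearD linearZ /= Gx Gy scalerDr !scalerA mulrC.
- by rewrite /Gr rmorph1 scale1r.
- by move=> b c x y Gx Gy; rewrite /Gr rmorphM /= Gx Gy -scalerAl -scalerAr scalerA signr_addb.
- case=> i; rewrite /Gr /= ?expr1 ?scaleN1r ?scale1r.
    by apply/(even_componentP k two_neq0).
  by apply/(odd_componentP k two_neq0).
Qed.

(** Stability: composing a graded endomorphism with an admissible substitution is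
    again an admissible substitution. *)
Lemma T2_ideal_T2 : T2_ideal (T2 G0 G1).
Proof.
split.
  split.
  - by move=> s _ _; rewrite (raddf0 (subst s)).
  - move=> f g If Ig s evs ods.
    by rewrite (rmorphD (subst s) f g) /= If ?Ig ?addr0.
  - move=> f g If; split=> s evs ods.
      by rewrite (rmorphM (subst s) g f) /= If ?mulr0.
    by rewrite (rmorphM (subst s) f g) /= If ?mul0r.
move=> h gr_h f If s evs ods.
pose s' v := subst s (h (var F v)).
have -> : subst s (h f) = subst s' f.
  apply: (@eq_free_morphism F G (subst s \o h) (subst s')) => v.
  exact/esym/subst_var.
apply: If => i.
  apply/(even_componentP k two_neq0).
  rewrite (@homogeneous_subst_grassmann s false) ?scale1r //.
  by apply/gr_h/(@homogeneous_var F (inl i)).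
apply/(odd_componentP k two_neq0).
rewrite (@homogeneous_subst_grassmann s true) ?scaleN1r //.
by apply/gr_h/(@homogeneous_var F (inr i)).
Qed.

End SoundnessT2.

Section Generators.
Context (F : finFieldType) (p q k : nat).
Hypotheses (card_F : #|F| = q) (char_F : p \in [pchar F]) (p_gt2 : (2 < p)%N).
Local Notation G := (grassmann F).
Local Notation FX := (free_alg F).
Local Notation G0 := (even_component (@gphi F k)).
Local Notation G1 := (odd_component (@gphi F k)).

Lemma two_neq0 : 2%:R != 0 :> F.
Proof.
apply/negP => char2; have p2 : 2 \in [pchar F] by rewrite inE char2.
by move: p2; rewrite (pcharf_eq char_F) inE => /eqP p2; have := p_gt2; rewrite -p2.
Qed.

Lemma odd_component_exp_p (a : G) : G1 a -> a ^+ p = 0.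
Proof.
move=> oda; apply: (gspan_exp_p char_F p_gt2).
apply: gspan_sub (odd_component_gspan oda) => S.
by apply: contraL => /eqP ->; rewrite big_seq_fset0.
Qed.

Lemma grassmann_exp_pq (a : G) : a ^+ (p * q) = a ^+ p.
Proof.
have [x ax] := grassmann_exp_p char_F p_gt2 a; rewrite exprM ax.
rewrite -[_%:A ^+ q]/((in_alg G (x ^+ p)) ^+ q) -rmorphXn /=.
by rewrite -card_F expf_card.
Qed.

Lemma I3_generators_T2 : (@I3_generators F p q k `<=` T2 G0 G1)%classic.
Proof.
move=> f [[[[v1 [v2 [v3 ->]]]|->]|->]|->] s evs ods.
- transitivity (lie (lie (s v1) (s v2)) (s v3)); last exact: grassmann_lie_lie.
  rewrite -(subst_var s v1) -(subst_var s v2) -(subst_var s v3).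
  by rewrite -2!(rmorph_lie (subst s)).
- transitivity (\prod_(i < k.+1) s (inr (nat_of_ord i))).
    2: exact: (@odd_component_prod F k (fun i => s (inr i))).
  rewrite (rmorph_prod (subst s)); apply: eq_bigr => i _; exact: subst_var.
- transitivity (s (inr 0) ^+ p); last exact: odd_component_exp_p.
  by rewrite (rmorphXn (subst s)); congr (_ ^+ _); apply: subst_var.
- transitivity (s (inl 0) ^+ (p * q) - s (inl 0) ^+ p).
    rewrite (rmorphB (subst s)) !(rmorphXn (subst s)).
    by congr (_ ^+ _ - _ ^+ _); apply: subst_var.
  by rewrite grassmann_exp_pq subrr.
Qed.

Lemma I3_sub_T2 : (@I3 F p q k `<=` T2 G0 G1)%classic.
Proof.
move=> f; apply; split; last exact: I3_generators_T2.
exact: T2_ideal_T2 two_neq0.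
Qed.

End Generators.

(** * Consequences of the generators *)

(** The double commutator is trilinear, so its membership in I need only be tested
    on a spanning set W. *)
Lemma lie_lie_closed (F : fieldType) (A : lalgType F) (I W : A -> Prop) :
    (forall c (a b : A), c *: (a * b) = a * (c *: b)) ->
    (forall P : A -> Prop, P 0 ->
      (forall c w a, W w -> P a -> P (c *: w + a)) -> forall a, P a) ->
    I 0 -> (forall a b, I a -> I b -> I (a + b)) -> (forall c a, I a -> I (c *: a)) ->
    (forall u v w, W u -> W v -> W w -> I (lie (lie u v) w)) ->
  forall a b c, I (lie (lie a b) c).
Proof.
move=> ZrA ind I0 ID IZ IW a b c.
have lieP x (u v w : A) : lie (x *: u + v) w = x *: lie u w + lie v w.
  by rewrite lieDl; congr (_ + _); rewrite /lie -scalerAl -ZrA scalerBr.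
have liePr x (u v w : A) : lie w (x *: u + v) = x *: lie w u + lie w v.
  by rewrite lieDr; congr (_ + _); rewrite /lie -scalerAl -ZrA scalerBr.
elim/ind: a => [|x u a Wu IHa]; first by rewrite !lie0l.
rewrite (lieP x u a b) (lieP x (lie u b)); apply: (ID _ _ _ IHa); apply: (IZ).
elim/ind: b {IHa} => [|y v b Wv IHb]; first by rewrite lie0r lie0l.
rewrite (liePr y v b u) (lieP y (lie u v) (lie u b) c); apply: (ID _ _ _ IHb); apply: (IZ).
elim/ind: c {IHb} => [|z w c Ww IHc]; first by rewrite lie0r.
by rewrite (liePr z w c); apply: (ID _ _ _ IHc); apply: (IZ); apply: (IW).
Qed.

(** Cut a word after each of its first j letters satisfying P. *)
Lemma split_count (T : Type) (P : pred T) (j : nat) (w : seq T) :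
    (j <= count P w)%N ->
  exists us r, [/\ size us = j, all (fun u => count P u == 1%N) us & w = flatten us ++ r].
Proof.
elim: j => [|j IH] lej; first by exists [::], w.
have [us [r [sz al wE]]] := IH (ltnW lej).
have: has P r.
  rewrite has_count -(ltn_add2l j) addn0; apply: (leq_trans lej).
  rewrite wE count_cat leq_add2r count_flatten -sz.
  elim: us al {sz wE} => //= u us IHus /andP[/eqP -> al]; exact: IHus.
move=> hasr; case/split_find: hasr wE => z r1 r2 Pz /negPf r1P wE.
exists (rcons us (rcons r1 z)), r2; split.
- by rewrite size_rcons sz.
- rewrite all_rcons al -cats1 count_cat /= Pz andbT addn0 addn1 eqSS.
  by rewrite -leqn0 leqNgt -has_count r1P.
- by rewrite wE flatten_rcons catA.
Qed.

Lemma T2_ideal_T2_ideal_generated (F : fieldType) (S : set (free_alg F)) :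
  T2_ideal (T2_ideal_generated S).
Proof.
split; last by move=> h gr f If J JT; apply: (JT.1.2) => //; exact: If.
split.
- by move=> J [[[]]].
- by move=> f g If Ig J JT; case: (JT.1.1) => _ + _; apply; [exact: If | exact: Ig].
- by move=> f g If; split=> J JT; case: (JT.1.1) => _ _ /(_ f g (If J JT)) [].
Qed.

Section I3Consequences.
Context (F : fieldType) (p q k : nat).
Local Notation FX := (free_alg F).
Local Notation I := (@I3 F p q k).

Lemma I3_generator f : @I3_generators F p q k f -> I f.
Proof. by move=> Sf J [_]; apply. Qed.

Let ideal : T2_ideal I.
Proof. exact: T2_ideal_T2_ideal_generated. Qed.

Lemma I3_0 : I 0.
Proof. by case: ideal.1. Qed.

Lemma I3D f g : I f -> I g -> I (f + g).
Proof. by case: ideal.1 => _ h _; apply: h. Qed.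

Lemma I3Ml f g : I f -> I (g * f).
Proof. by move=> If; case: ideal.1 => _ _ /(_ f g If)[]. Qed.

Lemma I3Mr f g : I f -> I (f * g).
Proof. by move=> If; case: ideal.1 => _ _ /(_ f g If)[]. Qed.

Lemma I3Z c f : I f -> I (c *: f).
Proof. by rewrite -mulr_algl; apply: I3Ml. Qed.

Lemma I3_endo (s : variable -> FX) f :
  (forall v, homogeneous (is_z v) (s v)) -> I f -> I (free_endo s f).
Proof. by move=> hs If; apply: (ideal.2 (free_endo s)) => //; apply: graded_free_endo. Qed.

(** Words are homogeneous, so three words are the values of three variables of the
    right degrees under a graded endomorphism. *)
Lemma I3_lie_lie (f g h : FX) : I (lie (lie f g) h).
Proof.
apply: (@lie_lie_closed F FX I (fun f => exists w, f = word F w)).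
- exact: free_scalerAr.
- by move=> P P0 PD; apply: free_alg_ind => // c w f'; apply: PD; exists w.
- exact: I3_0.
- exact: I3D.
- exact: I3Z.
move=> _ _ _ [w1 ->] [w2 ->] [w3 ->].
(* The index i keeps the three variables distinct, whatever their degrees. *)
pose v w i : variable := if odd (count is_z w) then inr i else inl i.
have zv w i : is_z (v w i) = odd (count is_z w) by rewrite /v; case: ifP.
have vE w w' i j : (v w i == v w' j) -> i = j.
  by rewrite /v; do 2 case: ifP => _; move=> // /eqP[].
pose s u := if u == v w1 0%N then word F w1 else if u == v w2 1%N then word F w2
  else if u == v w3 2%N then word F w3 else 0.
have hs u : homogeneous (is_z u) (s u).
  rewrite /s; do 3 (case: eqP => [->|_]; first by rewrite zv; apply: homogeneous_word).
  exact: homogeneous0.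
have s1 : free_endo s (var F (v w1 0%N)) = word F w1.
  by rewrite [LHS]subst_var /s eqxx.
have s2 : free_endo s (var F (v w2 1%N)) = word F w2.
  by rewrite [LHS]subst_var /s eqxx; case: eqP => // /eqP /vE.
have s3 : free_endo s (var F (v w3 2%N)) = word F w3.
  by rewrite [LHS]subst_var /s eqxx; do 2 case: eqP => [/eqP /vE // | _].
rewrite -s1 -s2 -s3 -2!(rmorph_lie (free_endo s)); apply: I3_endo => //.
by apply: I3_generator; left; left; left; exists (v w1 0%N), (v w2 1%N), (v w3 2%N).
Qed.

(** Such a word starts with k+1 factors that contain exactly one z each, hence are
    odd: it is a multiple of a graded substitution instance of z_1 ... z_(k+1). *)
Lemma I3_word_many_z w : (k < count is_z w)%N -> I (word F w).
Proof.
case/split_count => us [r [sz al ->]]; rewrite word_cat; apply: I3Mr.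
pose s (v : variable) := if v is inr i then
  if (i < k.+1)%N then word F (nth [::] us i) else 0 else 0.
have hs v : homogeneous (is_z v) (s v).
  case: v => i /=; first exact: homogeneous0.
  case: ifP => [ltik|_]; last exact: homogeneous0.
  have := @homogeneous_word F (nth [::] us i).
  by rewrite (eqP (all_nthP [::] al i _)) ?sz.
have -> : word F (flatten us) = free_endo s (\prod_(i < k.+1) zvar F i).
  rewrite (rmorph_prod (free_endo s)) /word big_flatten (big_nth [::]) sz big_mkord.
  by apply: eq_bigr => i _; rewrite [RHS]subst_var /= ltn_ord.
by apply: I3_endo => //; apply: I3_generator; left; left; right.
Qed.

Lemma I3_z_exp i : I (zvar F i ^+ p).
Proof.
pose s (v : variable) := if v == inr 0%N then zvar F i else 0.
have hs v : homogeneous (is_z v) (s v).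
  rewrite /s; case: eqP => [->|_]; last exact: homogeneous0.
  exact: (@homogeneous_var F (inr i)).
have s0 : free_endo s (zvar F 0) = zvar F i by exact: subst_var.
rewrite -s0 -(rmorphXn (free_endo s)).
by apply: I3_endo => //; apply: I3_generator; left; right.
Qed.

Lemma I3_even_exp g : homogeneous false g -> I (g ^+ (p * q) - g ^+ p).
Proof.
move=> hg; pose s (v : variable) := if v == inl 0%N then g else 0.
have hs v : homogeneous (is_z v) (s v).
  by rewrite /s; case: eqP => [->|_] //; exact: homogeneous0.
have s0 : free_endo s (yvar F 0) = g by exact: subst_var.
rewrite -s0 -!(rmorphXn (free_endo s)) -(rmorphB (free_endo s)).
by apply: I3_endo => //; apply: I3_generator; right.
Qed.

End I3Consequences.

(** * Normal monomials at central plus anticommuting points *)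

Section Evaluation.
Context (R : pzRingType) (T : finType) (u g : T -> R).
Hypothesis central_u : forall t a, u t * a = a * u t.
Hypothesis anti_g : forall s t, g s * g t = - (g t * g s).
Hypothesis sqr_g : forall t, g t * g t = 0.
Let x t := u t + g t.

Lemma lie_evaluation s t : lie (x s) (x t) = g s * g t *+ 2.
Proof.
have lie_u a b : lie (u a) b = 0 by apply/lie0P.
rewrite lieDl lie_u add0r lieDr lie_anti lie_u oppr0 add0r /lie.
by rewrite [g t * g s]anti_g opprK mulr2n.
Qed.

Lemma lie_prod_evaluation (l : seq T) : ~~ odd (size l) ->
  lie_prod [seq x t | t <- l] = (\prod_(t <- l) g t) *+ 2 ^ (size l)./2.
Proof.
elim/size2_ind: l => [|//|s t l IH] /=; first by rewrite big_nil.
rewrite negbK => /IH ->; rewrite lie_evaluation mulrnAl mulrnAr -mulrnA -expnSr.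
by rewrite !big_cons mulrA.
Qed.

Lemma lie_prod_evaluation0 (l : seq T) t :
  t \in l -> g t = 0 -> lie_prod [seq x s | s <- l] = 0.
Proof.
move=> tl gt; elim/size2_ind: l tl => [//|//|a b l IH] /=.
rewrite !inE lie_evaluation => /or3P[/eqP <-|/eqP <-|/IH ->].
- by rewrite gt !mul0r mul0rn mul0r.
- by rewrite gt mulr0 mul0rn mul0r.
- by rewrite mulr0.
Qed.

Lemma mul_g_prod (l : seq T) t : t \in l -> g t * \prod_(s <- l) g s = 0.
Proof.
elim: l => [//|s l IH]; rewrite inE big_cons => /orP[/eqP <-|/IH gl].
  by rewrite mulrA sqr_g mul0r.
by rewrite mulrA anti_g mulNr -mulrA gl mulr0 oppr0.
Qed.

(** Every g_t in the expansion moves to the right past the central u_t, where it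
    meets a. *)
Lemma exp_evaluation t n a : g t * a = 0 -> x t ^+ n * a = u t ^+ n * a.
Proof.
move=> ga; elim: n => [//|n IH]; rewrite exprS -mulrA IH mulrDl.
have -> : g t * (u t ^+ n * a) = u t ^+ n * (g t * a).
  rewrite !mulrA; congr (_ * _); elim: n {IH} => [|n IH]; first by rewrite mul1r mulr1.
  by rewrite exprS mulrA -central_u -!mulrA IH.
by rewrite ga mulr0 addr0 exprS mulrA.
Qed.

(** The commutators turn into the product of the g's, which absorbs every further
    g_t, so the powers of the letters reduce to powers of their central parts. *)
Lemma lie_monomial_evaluation p (i : {ffun T -> 'I_p} * {set T}) :
    (forall t, t \notin i.2 -> g t = 0) -> ~~ odd #|i.2| ->
  lie_monomial x i =
    ((\prod_t u t ^+ i.1 t) * \prod_(t <- enum i.2) g t) *+ 2 ^ (#|i.2|)./2.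
Proof.
move=> g0 ev; rewrite /lie_monomial lie_prod_evaluation -?cardE //.
rewrite mulrnAr; congr (_ *+ _); set P := \prod_(t <- enum _) g t.
have gP t : g t * P = 0.
  have [tJ|/g0 ->] := boolP (t \in i.2); last by rewrite mul0r.
  by apply: mul_g_prod; rewrite mem_enum.
elim: (index_enum T) => [|t l IH]; first by rewrite !big_nil.
rewrite !big_cons -!mulrA IH; apply: exp_evaluation; rewrite mulrA.
have -> : g t * \prod_(j <- l) u j ^+ i.1 j = (\prod_(j <- l) u j ^+ i.1 j) * g t.
  elim: l {IH} => [|s l IH]; first by rewrite big_nil mul1r mulr1.
  rewrite big_cons -mulrA -IH !mulrA; congr (_ * _).
  by elim: (i.1 s : nat) => [|n IHn]; rewrite ?mul1r ?mulr1 // exprS mulrA -central_u -!mulrA IHn.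
by rewrite -mulrA gP mulr0.
Qed.

End Evaluation.

(** Expanding the power of a sum of m commuting elements of square zero, only the
    products of distinct summands survive. *)
Lemma exp_sum_sqr0 (R : pzRingType) (e : nat -> R) m :
    (forall l a, e l * a = a * e l) -> (forall l, e l * e l = 0) ->
  (\sum_(l < m) e l) ^+ m = (\prod_(l < m) e l) *+ m`! /\
  (\sum_(l < m) e l) ^+ m.+1 = 0.
Proof.
move=> central sqr0.
have step n a l : (a + e l) ^+ n.+1 = a ^+ n.+1 + (a ^+ n * e l) *+ n.+1.
  elim: n => [|n IH]; first by rewrite !expr1 mul1r.
  rewrite exprSr IH mulrDr !mulrDl -exprSr mulrnAl mulrnAl -!mulrA sqr0 mulr0 mul0rn addr0.
  by rewrite (central l a) mulrA -exprSr -addrA -mulrSr.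
elim: m => [|m [IH IH0]]; first by rewrite !big_ord0 expr1.
rewrite !big_ord_recr /= !step IH0 IH add0r; split.
  by rewrite mulrnAl -mulrnA factS mulnC.
by rewrite exprS IH0 mulr0 mul0r mul0rn addr0.
Qed.

(** * Generic nilpotent points of the Grassmann algebra *)

Lemma gbasis_neq0 (F : fieldType) (S : {fset nat}) : gbasis F S != 0.
Proof.
by rewrite gbasis.unlock grassmann0E (monalgU_eq0 (K := {fset nat})) oner_eq0.
Qed.

(** The product is, up to sign, the basis element of the union; any set disjoint
    from all the factors is disjoint from that union. *)
Lemma prod_gbasis_disjoint (F : fieldType) (ss : seq {fset nat}) :
    pairwise (fun S T => [disjoint S & T]%fset) ss ->
  \prod_(S <- ss) gbasis F S != 0.
Proof.
move=> ds; suff [b [U [-> _]]] : exists b : bool, exists U : {fset nat},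
    \prod_(S <- ss) gbasis F S = (-1) ^+ b *: gbasis F U /\
    forall S, all (fun T => [disjoint S & T]%fset) ss -> [disjoint S & U]%fset.
  by rewrite scaler_eq0 negb_or signr_eq0 gbasis_neq0.
elim: ss ds => [_|S ss IH] /=.
  exists false, fset0; rewrite big_nil scale1r gbasis0; split=> // S _.
  exact: fdisjointX0.
case/andP=> dS /IH[b [U [e dU]]].
exists (odd (b + inversions S U)), (S `|` U)%fset; split=> [|S' /andP[dS' /dU]].
  rewrite big_cons e -scalerAr gbasisM /gmul_basis dU //.
  by rewrite scalerA -exprD signr_odd.
by rewrite fdisjointXU dS'.
Qed.

Section Slots.
Context (n p k : nat).
Local Notation T := ('I_n + 'I_n)%type.
Context (r : {ffun T -> 'I_p}) (J : {set T}).

Definition z_index (t : T) : bool := if t is inr _ then true else false.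

(** One slot (t, Some l) for each of the r_t factors t, and one slot (t, None) for
    each t in J. *)
Definition slots : seq (T * option nat) :=
  [seq (t, Some l) | t <- index_enum T, l <- iota 0 (r t)] ++
  [seq (t, None) | t <- enum J].

Let z_slots := [seq s <- slots | z_index s.1].

(** The first generator assigned to a slot.  The slots of letters z are numbered
    below k, and so receive negated generators; the others get an index k + 2m,
    leaving k + 2m + 1 for the second generator of the slot. *)
Definition head_index (s : T * option nat) : nat :=
  if z_index s.1 then index s z_slots else (k + (choice.pickle s).*2)%N.

Definition tail_index (s : T * option nat) : nat := (k + (choice.pickle s).*2).+1.

Definition block (s : T * option nat) : {fset nat} :=
  if s.2 is Some _ then [fset head_index s; tail_index s]%fset
  else [fset head_index s]%fset.

(** Counts the slots of letters z, that is, the degree in the z's of the normal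
    monomial with exponents r and commutator letters J. *)
Definition z_degree : nat :=
  (\sum_t z_index t * r t + \sum_(t in J) z_index t)%N.

Hypothesis z_degree_le : (z_degree <= k)%N.

Lemma mem_slots t o : ((t, o) \in slots) =
  if o is Some l then (l < r t)%N else t \in J.
Proof.
rewrite mem_cat; case: o => [l|].
  rewrite [X in _ || X](_ : _ = false) ?orbF; last by apply/mapP => -[].
  apply/allpairsPdep/idP => [[t' [l' [_ + [-> ->]]]]|lt]; first by rewrite mem_iota.
  by exists t, l; rewrite mem_index_enum mem_iota.
rewrite [X in X || _](_ : _ = false) ?orFb; last by apply/allpairsPdep => -[? [? []]].
by rewrite mem_map ?mem_enum // => a b [].
Qed.

Lemma slots_uniq : uniq slots.
Proof.
rewrite cat_uniq allpairs_uniq_dep ?index_enum_uniq //=; last first.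
- by move=> [t l] [t' l'] _ _ /= [-> ->].
- by move=> t _; apply: iota_uniq.
rewrite map_inj_uniq ?enum_uniq ?andbT; last by move=> a b [].
by apply/hasPn => s /mapP[t _ ->]; apply/allpairsPdep => -[? [? []]].
Qed.

Lemma size_z_slots : size z_slots = z_degree.
Proof.
rewrite size_filter -sum1_count big_mkcond big_cat /= big_allpairs_dep big_map.
congr (_ + _)%N; last first.
  by rewrite big_enum /=; apply: eq_bigr => t _; case: ifP.
apply: eq_bigr => t _ /=; rewrite big_const_seq count_predT size_iota iter_addn_0.
by case: (z_index t).
Qed.

Lemma head_index_z s : s \in slots -> (head_index s < k)%N = z_index s.1.
Proof.
move=> ss; rewrite /head_index; case: ifP => zs; last by rewrite ltnNge leq_addr.
by rewrite (leq_trans _ z_degree_le) // -size_z_slots index_mem mem_filter zs.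
Qed.

Lemma head_index_inj : {in slots &, injective head_index}.
Proof.
move=> s1 s2 ss1 ss2 e.
have ez : z_index s1.1 = z_index s2.1 by rewrite -!head_index_z // e.
move: e; rewrite /head_index -ez; case: ifP => zs.
  by apply: (index_inj s1 (s := z_slots)); rewrite /z_slots mem_filter -?ez zs.
by move/addnI/double_inj/(pcan_inj choice.pickleK).
Qed.

Lemma head_index_neq s s' : s \in slots -> (head_index s == tail_index s') = false.
Proof.
move=> ss; have := head_index_z ss; rewrite /head_index /tail_index.
by case: ifP => zs; lia.
Qed.

Lemma block_disjoint s1 s2 : s1 \in slots -> s2 \in slots -> s1 != s2 ->
  [disjoint block s1 & block s2]%fset.
Proof.
move=> ss1 ss2 n12; apply/fdisjointP => i.
have h12 : head_index s1 == head_index s2 = false.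
  by apply: contraNF n12 => /eqP /head_index_inj ->.
have tt : tail_index s1 == tail_index s2 = false.
  by apply: contraNF n12 => /eqP[/addnI/double_inj/(pcan_inj choice.pickleK) ->].
rewrite /block; case: s1.2 s2.2 => [?|] [?|]; rewrite !inE;
 [case/orP=> /eqP ->|case/orP=> /eqP ->|move/eqP->|move/eqP->];
 by rewrite ?h12 ?tt ?head_index_neq // eq_sym head_index_neq.
Qed.

Lemma card_block s : s \in slots -> odd #|` block s| = ~~ s.2.
Proof.
move=> ss; rewrite /block; case: s.2 => [l|]; last by rewrite cardfs1.
by rewrite cardfs2 head_index_neq.
Qed.

Lemma block_weight s : s \in slots -> (\sum_(i <- block s) (i < k))%N = z_index s.1.
Proof.
move=> ss; rewrite /block; case: s.2 => [l|]; last by rewrite big_seq_fset1 head_index_z.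
rewrite sum_fsetU ?fdisjoint1X ?inE ?head_index_neq //.
by rewrite !big_seq_fset1 head_index_z // ltnNge /tail_index -addnS leq_addr addn0.
Qed.

Lemma block_neq0 s : block s != fset0.
Proof.
apply/fset0Pn; exists (head_index s); rewrite /block.
by case: s.2 => [l|]; rewrite !inE eqxx.
Qed.

Section GenericPoint.
Context (F : fieldType).
Local Notation G := (grassmann F).
Local Notation gbasis := (gbasis F).

Definition central_part (t : T) : G := \sum_(l < r t) gbasis (block (t, Some (l : nat))).

Definition odd_part (t : T) : G := if t \in J then gbasis (block (t, None)) else 0.

Lemma block_central t l a : (l < r t)%N ->
  gbasis (block (t, Some l)) * a = a * gbasis (block (t, Some l)).
Proof. by move=> ltl; rewrite gbasis_even_central // card_block ?mem_slots. Qed.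

Lemma central_part_central t a : central_part t * a = a * central_part t.
Proof.
rewrite mulr_suml mulr_sumr; apply: eq_bigr => l _; exact: block_central.
Qed.

Lemma odd_part_anti s t : odd_part s * odd_part t = - (odd_part t * odd_part s).
Proof.
rewrite /odd_part; case: ifP => sJ; last by rewrite mul0r mulr0 oppr0.
case: ifP => tJ; last by rewrite mul0r mulr0 oppr0.
by rewrite gbasisC -signr_odd oddM !card_block ?mem_slots //= scaleN1r.
Qed.

Lemma odd_part_sqr t : odd_part t * odd_part t = 0.
Proof.
rewrite /odd_part; case: ifP => tJ; last by rewrite mul0r.
by rewrite -[X in X * _]mulr1 gbasis_sandwich ?block_neq0.
Qed.

Lemma exp_central_part t :
  central_part t ^+ r t =
    (\prod_(l < r t) gbasis (block (t, Some (l : nat)))) *+ (r t)`! /\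
  central_part t ^+ (r t).+1 = 0.
Proof.
(* Extended by 0 so that centrality and square zero hold for all l. *)
pose e l := if (l < r t)%N then gbasis (block (t, Some l)) else 0.
have uE : central_part t = \sum_(l < r t) e l.
  by apply: eq_bigr => l _; rewrite /e ltn_ord.
have -> : \prod_(l < r t) gbasis (block (t, Some (l : nat))) = \prod_(l < r t) e l.
  by apply: eq_bigr => l _; rewrite /e ltn_ord.
rewrite uE; apply: exp_sum_sqr0 => [l a|l]; rewrite /e; case: ifP => ltl.
- exact: block_central.
- by rewrite mul0r mulr0.
- by rewrite -[X in X * _]mulr1 gbasis_sandwich ?block_neq0.
- by rewrite mul0r.
Qed.

Lemma gphi_generic_point t :
  gphi k (central_part t + odd_part t) =
    (-1) ^+ (z_index t) *: (central_part t + odd_part t).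
Proof.
rewrite linearD scalerDr scaler_sumr raddf_sum; congr (_ + _).
  by apply: eq_bigr => l _; rewrite [LHS]gphi_basis block_weight ?mem_slots.
rewrite /odd_part; case: ifP => tJ; last by rewrite scaler0 raddf0.
by rewrite [LHS]gphi_basis block_weight ?mem_slots.
Qed.

(** Having no scalar part makes the generic points nilpotent. *)
Lemma gspan_generic_point t :
  gspan (fun S => S != fset0) (central_part t + odd_part t).
Proof.
apply: gspan_add; first by apply: gspan_sum => l _; apply/gspan_basis/block_neq0.
by rewrite /odd_part; case: ifP => _; [apply/gspan_basis/block_neq0 | exact: gspan0].
Qed.

(** The factorials coming from the powers u_t^(r_t) are invertible as r_t < p, and
    what remains is the product of the basis elements of all slots. *)
Lemma generic_monomial_neq0 : p \in [pchar F] ->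
  (\prod_t central_part t ^+ r t) * \prod_(t <- enum J) odd_part t != 0.
Proof.
move=> char_F.
have -> : \prod_t central_part t ^+ r t = (\prod_t ((r t)`!)%:R : F) *:
    \prod_t \prod_(l < r t) gbasis (block (t, Some (l : nat))).
  rewrite -scaler_prod; apply: eq_bigr => t _.
  by rewrite (exp_central_part t).1 scaler_nat.
rewrite -scalerAl scaler_eq0 negb_or; apply/andP; split.
  apply/prodf_neq0 => t _; rewrite -(dvdn_pcharf char_F).
  have p_pr := pcharf_prime char_F.
  elim: (r t : nat) (ltn_ord (r t)) => [|m IH] ltm; first by rewrite Euclid_dvd1.
  by rewrite factS Euclid_dvdM // negb_or IH ?(ltnW ltm) // gtnNdvd.
have -> : (\prod_t \prod_(l < r t) gbasis (block (t, Some (l : nat)))) *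
    \prod_(t <- enum J) odd_part t = \prod_(S <- map block slots) gbasis S.
  rewrite big_map big_cat big_allpairs_dep big_map /=; congr (_ * _).
    apply: eq_bigr => t _; rewrite -[in RHS](subn0 (r t)).
    by rewrite -/(index_iota 0 (r t)) big_mkord.
  rewrite !big_seq; apply: eq_bigr => t; rewrite mem_enum => tJ.
  by rewrite /odd_part tJ.
apply: prod_gbasis_disjoint; rewrite pairwise_map.
apply: (@sub_in_pairwise _ (mem slots) (fun s t => s != t)).
- by move=> s t ss st; apply: block_disjoint.
- exact/allP.
- by rewrite -uniq_pairwise slots_uniq.
Qed.

End GenericPoint.

End Slots.

(** * Linear independence of normal monomials *)

Definition var_index n (t : 'I_n + 'I_n) : variable :=
  match t with inl i => inl (i : nat) | inr i => inr (i : nat) end.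

Section Independence.
Context (F : fieldType) (n p k : nat).
Hypotheses (char_F : p \in [pchar F]) (p_gt2 : (2 < p)%N) (two_neq0 : 2%:R != 0 :> F).
Local Notation T := ('I_n + 'I_n)%type.
Local Notation index := ({ffun T -> 'I_p} * {set T})%type.
Local Notation G := (grassmann F).

Lemma generic_substitution (x : T -> G) :
    (forall t, gphi k (x t) = (-1) ^+ (z_index t) *: x t) ->
    (forall t, gspan (fun S => S != fset0) (x t)) ->
  exists s, [/\ admissible k s, forall v, s v ^+ p = 0 &
                forall t, s (var_index t) = x t].
Proof.
move=> gx nx.
pose s (v : variable) := match v with
  | inl i => if insub i is Some j then x (inl j) else 0
  | inr i => if insub i is Some j then x (inr j) else 0 end.
exists s; split.
- split=> i /=; case: insub => [j|].
  + by apply/(even_componentP k two_neq0); rewrite gx scale1r.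
  + by apply/(even_componentP k two_neq0); rewrite raddf0.
  + by apply/(odd_componentP k two_neq0); rewrite gx scaleN1r.
  + by apply/(odd_componentP k two_neq0); rewrite raddf0 oppr0.
- move=> v; apply: (gspan_exp_p char_F p_gt2).
  by case: v => i /=; case: insub => [j|] //; exact: gspan0.
- by case=> i /=; rewrite valK.
Qed.

(** Induction on the cardinality of J, then on the sum of r.  At the generic point
    of (r, J) a monomial (r', J') with J' not inside J vanishes because some
    commutator has a central entry, one with J' strictly inside J has coefficient
    0 by induction, and so has one with J' = J and r' <= r; otherwise some
    exponent r'_t exceeds r_t and the power of u_t is 0. *)
Lemma lie_monomials_independent (c : index -> F) :
    (forall i, c i != 0 -> (z_degree i.1 i.2 <= k)%N /\ ~~ odd #|i.2|) ->
    (forall s, admissible k s -> (forall v, s v ^+ p = 0) ->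
      \sum_i c i *: lie_monomial (s \o @var_index n) i = 0) ->
  forall i, c i = 0.
Proof.
move=> adm vanish.
suff main a : forall b (r : {ffun T -> 'I_p}) (J : {set T}),
    #|J| = a -> (\sum_t r t)%N = b -> c (r, J) = 0.
  by case=> r J; apply: main.
elim/ltn_ind: a => a IHa b; elim/ltn_ind: b => b IHb r J cardJ sumr.
apply/eqP/negPn/negP => c_neq0; have [zle evJ] := adm _ c_neq0.
pose u := @central_part n p k r J F; pose g := @odd_part n p k r J F.
have [s [adm_s nil_s sE]] := generic_substitution
  (gphi_generic_point zle F) (gspan_generic_point k r J F).
have eval i : lie_monomial (s \o @var_index n) i = lie_monomial (fun t => u t + g t) i.
  rewrite /lie_monomial; congr (_ * lie_prod _); first by apply: eq_bigr => t _; rewrite /= sE.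
  by apply: eq_map => t; rewrite /= sE.
have u_central t a' : u t * a' = a' * u t by exact: central_part_central.
have g_anti t t' : g t * g t' = - (g t' * g t) by exact: odd_part_anti.
have g_sqr t : g t * g t = 0 by exact: odd_part_sqr.
have g0 t : t \notin J -> g t = 0 by move=> /negPf tJ; rewrite /g /odd_part tJ.
have := vanish s adm_s nil_s; rewrite (bigD1 (r, J)) //= big1 => [|[r' J'] neq_rJ].
  rewrite addr0 eval (lie_monomial_evaluation u_central) //=.
  rewrite -scaler_nat scalerA => /eqP; rewrite scaler_eq0 mulf_eq0 (negPf c_neq0) /=.
  rewrite natrX expf_eq0 (negPf two_neq0) andbF /=.
  by rewrite (negPf (generic_monomial_neq0 zle char_F)).
rewrite eval; have [c0|c'_neq0] := eqVneq (c (r', J')) 0; first by rewrite c0 scale0r.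
have [_ /= evJ'] := adm _ c'_neq0.
have [subJ|] := boolP (J' \subset J); last first.
  case/subsetPn => t tJ' tJ; rewrite /lie_monomial.
  rewrite (@lie_prod_evaluation0 _ _ u g u_central g_anti _ t) ?mem_enum ?g0 //.
  by rewrite mulr0 scaler0.
have [eqJ|neqJ] := eqVneq J' J; last first.
  have ltJ : (#|J'| < a)%N by rewrite -cardJ proper_card // finset.properEneq neqJ.
  by rewrite (IHa _ ltJ _ r' J' erefl erefl) eqxx in c'_neq0.
subst J'; have [t lt_rr' | le_r'r] := pickP (fun t => r t < r' t)%N.
  rewrite (lie_monomial_evaluation u_central) //=.
  have u0 : u t ^+ r' t = 0.
    by rewrite -(subnK lt_rr') exprD (exp_central_part zle F t).2 mulr0.
  suff -> : \prod_t u t ^+ r' t = 0 by rewrite mul0r mul0rn scaler0.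
  rewrite -[LHS]mulr1; apply: (prod_annihilate _ (mem_index_enum t)); last by rewrite u0 mul0r.
  by move=> ?; rewrite mul1r mulr1.
have ltr : (\sum_t r' t < b)%N.
  rewrite -sumr ltn_neqAle leq_sum ?andbT => [|t _]; last by rewrite leqNgt le_r'r.
  apply: contra neq_rJ => /eqP eq_sum; apply/eqP; congr (_, _); apply/ffunP => t.
  apply: val_inj; apply/eqP; rewrite eqn_leq leqNgt le_r'r /= leqNgt.
  apply/negP => lt_r'r.
  suff : (\sum_t r' t < \sum_t r t)%N by rewrite eq_sum ltnn.
  rewrite [ltnLHS](bigD1 t) // [ltnRHS](bigD1 t) //= -addSn leq_add // leq_sum //.
  by move=> t' _; rewrite leqNgt le_r'r.
by rewrite (IHb _ ltr r' J cardJ erefl) eqxx in c'_neq0.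
Qed.

End Independence.

(** * Indicators of scalars and filtrations *)

(** Both sides have degree below q and take the value 1 at the q points of F: at x
    the only nonzero summand is the one with b = x. *)
Lemma sum_indicator_poly (F : finFieldType) :
  \sum_(b : F) (1 - ('X - b%:P) ^+ #|F|.-1) = 1 :> {poly F}.
Proof.
apply/eqP; rewrite -subr_eq0; apply/eqP.
have cardF : #|F|.-1.+1 = #|F| by rewrite prednK // ltnW // finNzRing_gt1.
apply: (@roots_geq_poly_eq0 _ _ (enum F)).
- apply/allP => x _; rewrite /root hornerD hornerN hornerC horner_sum.
  rewrite (bigD1 x) //= big1 => [|b neq_bx]; rewrite !hornerE.
    by rewrite subrr expr0n -eqSS cardF (gtn_eqF (finNzRing_gt1 F)) subr0 ?addr0 subrr.
  have nz : x - b != 0 by rewrite subr_eq0 eq_sym.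
  apply/eqP; rewrite subr_eq0 eq_sym; apply/eqP/(mulfI nz).
  by rewrite mulr1 -exprS cardF expf_card.
- exact: enum_uniq.
- rewrite -cardE -cardF; apply: (leq_trans (size_polyD _ _)).
  rewrite geq_max size_polyN size_polyC oner_eq0 /= andbT.
  apply: (leq_trans (size_sum _ _ _)); apply/bigmax_leqP => b _.
  apply: (leq_trans (size_polyD _ _)).
  by rewrite geq_max size_polyN size_polyC oner_eq0 size_exp_XsubC leqnn.
Qed.

(** Since (y - a)^p = y^p - a^p and a |-> a^p permutes F, this is the value of the
    previous polynomial identity at y^p. *)
Lemma sum_indicators (F : finFieldType) (A : lalgType F) (p : nat) (y : A) :
    p \in [pchar F] -> (forall c (a b : A), c *: (a * b) = a * (c *: b)) ->
  \sum_(a : F) (1 - (y - a%:A) ^+ (p * #|F|.-1)) = 1.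
Proof.
move=> char_F ZrA; have char_A : p \in [pchar A] by rewrite pchar_lalg.
have commA (u : A) : commr_rmorph (in_alg A) u.
  by move=> c; rewrite /GRing.comm -ZrA mulr1 -scalerAl mul1r.
have Frob (a : F) : (y - a%:A) ^+ p = y ^+ p - (a ^+ p)%:A.
  rewrite -!(pFrobenius_autE char_A) pFrobenius_autB_comm; last exact: commA.
  by rewrite !pFrobenius_autE -[_%:A ^+ p]/((in_alg A a) ^+ p) -rmorphXn.
have inj_p : injective (fun a : F => a ^+ p).
  by move=> a b e; exact: (fmorph_inj (pFrobenius_aut char_F) e).
under eq_bigr => a _ do rewrite exprM Frob.
rewrite -(reindex_inj inj_p (P := predT) (F := fun b => 1 - (y ^+ p - b%:A) ^+ #|F|.-1)) /=.
have := congr1 (horner_morph (commA (y ^+ p))) (sum_indicator_poly F).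
rewrite rmorph_sum rmorph1 => e; apply: etrans e; apply: eq_bigr => b _.
by rewrite rmorphB rmorph1 rmorphXn rmorphB /= horner_morphX horner_morphC.
Qed.

Lemma mul_prod_annihilate (R : pzRingType) (I : eqType) (l : seq I) (f : I -> R) a i :
    (forall j b, f j * b = b * f j) -> i \in l -> a * f i = 0 ->
  a * \prod_(j <- l) f j = 0.
Proof.
move=> central + af; elim: l => [//|j l IH]; rewrite inE big_cons => /orP[/eqP <-|/IH e].
  by rewrite mulrA af mul0r.
by rewrite central mulrA e mul0r.
Qed.

Lemma prod_central (R : pzRingType) (I : Type) (l : seq I) (f : I -> R) b :
  (forall j, f j * b = b * f j) -> (\prod_(j <- l) f j) * b = b * \prod_(j <- l) f j.
Proof.
move=> central; elim: l => [|j l IH]; first by rewrite big_nil mul1r mulr1.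
by rewrite big_cons -mulrA IH !mulrA central.
Qed.

(** Expanding a product of translated letters gives a combination of products of
    the letters themselves. *)
Lemma words_translate (F : fieldType) (A : lalgType F) (T : Type) (x : T -> A)
    (a : T -> F) (P : A -> Prop) :
    (forall c (a b : A), c *: (a * b) = a * (c *: b)) ->
    (forall u v, P u -> P v -> P (u + v)) -> (forall c u, P u -> P (c *: u)) ->
    (forall l, P (\prod_(t <- l) x t)) ->
  forall l, P (\prod_(t <- l) (x t + (a t)%:A)).
Proof.
move=> ZrA PD PZ Px l.
suff main : forall l1, P (\prod_(t <- l1) x t * \prod_(t <- l) (x t + (a t)%:A)).
  by have := main [::]; rewrite big_nil mul1r.
elim: l => [|t l IH] l1; first by rewrite big_nil mulr1.
rewrite big_cons mulrDl mulrDr; apply: (PD).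
  by have := IH (rcons l1 t); rewrite -cats1 big_cat big_seq1 mulrA.
by rewrite mulr_algl -ZrA; apply: (PZ).
Qed.

(** When the set of commutator letters has odd size the monomial is 0; otherwise
    both terms of a commutator have the weight of its two letters together. *)
Lemma lie_monomial_filtration (A : pzRingType) (P : nat -> A -> Prop) (T : finType)
    (x : T -> A) (w : T -> nat) p (i : {ffun T -> 'I_p} * {set T}) :
    (forall j, P j 0) -> (forall j a b, P j a -> P j b -> P j (a - b)) -> P 0 1 ->
    (forall j l a b, P j a -> P l b -> P (j + l)%N (a * b)) ->
    (forall t, P (w t) (x t)) ->
  P (\sum_t w t * i.1 t + \sum_(t in i.2) w t)%N (lie_monomial x i).
Proof.
move=> P0 PB P1 PM Px; apply: (PM).
  elim: (index_enum T) => [|t l IH]; first by rewrite !big_nil.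
  rewrite !big_cons; apply: (PM) => //; elim: (i.1 t : nat) => [|m IHm].
    by rewrite muln0.
  by rewrite mulnS exprS; apply: (PM).
rewrite -big_enum /=; elim/size2_ind: (enum _) => [|t|t u l IH] /=.
- by rewrite big_nil.
- exact: P0.
- rewrite !big_cons addnA; apply: (PM) => //; apply: (PB); first exact: (PM).
  by rewrite addnC; apply: (PM).
Qed.

(** * Polynomials vanishing on the Grassmann algebra *)

Section ZDegree.
Context (F : fieldType).
Local Notation FX := (free_alg F).

(** The filtration of the free algebra by the number of letters z in each word. *)
Definition z_degree_ge (j : nat) (f : FX) : Prop :=
  forall m, m \in msupp f -> (j <= count is_z m)%N.

Lemma z_degree_ge0 j : z_degree_ge j 0.
Proof. by move=> m; rewrite msupp0 inE. Qed.

Lemma z_degree_geB j f g : z_degree_ge j f -> z_degree_ge j g -> z_degree_ge j (f - g).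
Proof.
move=> hf hg m /(fsubsetP (msuppB_le _ _)); rewrite inE.
by case/orP; [exact: hf | exact: hg].
Qed.

Lemma z_degree_geM j l f g :
  z_degree_ge j f -> z_degree_ge l g -> z_degree_ge (j + l) (f * g).
Proof.
move=> hf hg m /msuppM_le[m1 [m2 [m1f m2g ->]]].
by rewrite [mmul _ _]fmmulE /= count_cat leq_add ?hf ?hg.
Qed.

Lemma I3_z_degree (p q k : nat) f : z_degree_ge k.+1 f -> @I3 F p q k f.
Proof.
move=> hf; rewrite [f]monalgE big_seq; apply: big_ind.
- exact: I3_0.
- exact: I3D.
move=> m mf; rewrite -(fmK m) -scale_word; apply: I3Z.
by apply: I3_word_many_z; apply: hf.
Qed.

End ZDegree.

Section SpanModulo.
Context (F : fieldType) (A : lalgType F) (I : A -> Prop) (J : finType) (N : J -> A) (E : A).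
Hypothesis ID : forall f g, I f -> I g -> I (f + g).
Hypothesis IZ : forall c f, I f -> I (c *: f).

(** Stated in A itself rather than in its quotient by I, so that the relation can
    be evaluated at points of the Grassmann algebra. *)
Definition span_modulo (f : A) : Prop :=
  exists c : J -> F, I ((f - \sum_i c i *: N i) * E).

Lemma span_moduloD f g : span_modulo f -> span_modulo g -> span_modulo (f + g).
Proof.
move=> [c Ic] [d Id]; exists (fun i => c i + d i).
have -> : (f + g - \sum_i (c i + d i) *: N i) * E =
    (f - \sum_i c i *: N i) * E + (g - \sum_i d i *: N i) * E.
  rewrite -mulrDl addrACA -opprD -big_split /=; congr ((_ - _) * _).
  by apply: eq_bigr => i _; rewrite scalerDl.
exact: ID.
Qed.

Lemma span_moduloZ x f : span_modulo f -> span_modulo (x *: f).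
Proof.
move=> [c Ic]; exists (fun i => x * c i).
have -> : (x *: f - \sum_i (x * c i) *: N i) * E = x *: ((f - \sum_i c i *: N i) * E).
  rewrite scalerAl scalerBr scaler_sumr; congr ((_ - _) * _).
  by apply: eq_bigr => i _; rewrite scalerA.
exact: IZ.
Qed.

Lemma span_modulo0 : I 0 -> span_modulo 0.
Proof.
exists (fun=> 0); rewrite big1 ?subrr ?mul0r // => i _; exact: scale0r.
Qed.

(** Coefficients of elements already in I may be changed freely. *)
Lemma span_modulo_eq (c d : J -> F) f : (forall i, I (N i) \/ c i = d i) ->
    (forall g, I g -> I (g * E)) -> I 0 ->
  I ((f - \sum_i c i *: N i) * E) -> I ((f - \sum_i d i *: N i) * E).
Proof.
move=> cd IME I0 If.
have -> : (f - \sum_i d i *: N i) * E =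
    (f - \sum_i c i *: N i) * E + (\sum_i (c i - d i) *: N i) * E.
  rewrite -mulrDl; congr (_ * _); rewrite -addrA; congr (_ + _).
  by rewrite -!sumrN -big_split; apply: eq_bigr => i _ /=; rewrite scalerBl addKr.
apply: ID => //; apply: IME; apply: big_ind => // i _.
by case: (cd i) => [IN|->]; [exact: IZ | rewrite subrr scale0r].
Qed.

End SpanModulo.

Section Completeness.
Context (F : finFieldType) (p q k : nat).
Hypotheses (card_F : #|F| = q) (char_F : p \in [pchar F]) (p_gt2 : (2 < p)%N).
Local Notation G := (grassmann F).
Local Notation FX := (free_alg F).
Local Notation I := (@I3 F p q k).
Local Notation T2G := (T2 (even_component (@gphi F k)) (odd_component (@gphi F k))).

Section Localized.
Context (n : nat) (a : {ffun 'I_n -> F}).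
Local Notation T := ('I_n + 'I_n)%type.
Local Notation index := ({ffun T -> 'I_p} * {set T})%type.

Definition shift (t : T) : F := if t is inl i then a i else 0.

Definition centred (t : T) : FX := var F (var_index t) - (shift t)%:A.

(** Cuts out the part where the y_i have scalar parts a_i. *)
Definition indicator : FX :=
  \prod_(i < n) (1 - (yvar F i - (a i)%:A) ^+ (p * #|F|.-1)).

Lemma centred_homogeneous (i : nat) (c : F) : homogeneous false (yvar F i - c%:A).
Proof.
apply: homogeneousD; first exact: (@homogeneous_var F (inl i)).
rewrite -scaleN1r; do 2 apply: homogeneousZ.
by have := @homogeneous_word F [::]; rewrite /word big_nil.
Qed.

Lemma centred_z_degree t : z_degree_ge (z_index t) (centred t).
Proof.
case: t => i; first by move=> m _.
rewrite /centred /= scale0r subr0 => m.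
by rewrite msuppU1 inE => /eqP ->; rewrite fmuE.
Qed.

Lemma I3_lie_monomial_z (i : index) :
  (k < z_degree i.1 i.2)%N -> I (lie_monomial centred i).
Proof.
move=> ltk; apply: I3_z_degree => m mi; apply: (leq_trans ltk); move: m mi.
apply: (@lie_monomial_filtration FX (@z_degree_ge F)).
- exact: z_degree_ge0.
- exact: z_degree_geB.
- by [].
- exact: z_degree_geM.
- exact: centred_z_degree.
Qed.

(** In the quotient by I the element y^p is central, as [y^p, x] = p y^(p-1) [y, x];
    so is the indicator, which is killed by (y_i - a_i)^p because
    g^(pq) = g^p for g = y_i - a_i. *)
Lemma indicator_word_spanned (l : seq T) : exists c : index -> int,
  I ((\prod_(t <- l) centred t - \sum_i lie_monomial centred i *~ c i) * indicator).
Proof.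
have [R [pi [piP pi_surj]]] := @two_sided_quotient FX I (@I3_0 F p q k)
  (@I3D F p q k) (fun f g If => conj (@I3Ml F p q k f g If) (@I3Mr F p q k f g If)).
have nil2 (u v w : R) : lie (lie u v) w = 0.
  have [f ->] := pi_surj u; have [g ->] := pi_surj v; have [h ->] := pi_surj w.
  rewrite -!(rmorph_lie pi); apply/piP; exact: I3_lie_lie.
have natp (u : R) : u *+ p = 0.
  have [f ->] := pi_surj u.
  have fp : f *+ p = 0 by apply: mulrn_pchar; rewrite pchar_lalg.
  by rewrite -(raddfMn pi) fp (raddf0 pi).
have p_central u v : pi u ^+ p * v = v * pi u ^+ p.
  by rewrite (exp_lie nil2) natp addr0.
pose e (i : 'I_n) : R := 1 - (pi (yvar F i - (a i)%:A)) ^+ (p * #|F|.-1).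
have e_central i v : e i * v = v * e i.
  rewrite /e mulrBl mulrBr mul1r mulr1 exprM; congr (_ - _).
  elim: #|F|.-1 => [|j IH]; first by rewrite mul1r mulr1.
  by rewrite exprS -mulrA IH !mulrA p_central.
have piE : pi indicator = \prod_(i < n) e i.
  rewrite (rmorph_prod pi); apply: eq_bigr => i _.
  by rewrite (rmorphB pi) (rmorph1 pi) (rmorphXn pi).
have xE t : pi (centred t) ^+ p * pi indicator = 0.
  case: t => i; last first.
    rewrite /centred /= scale0r subr0 -(rmorphXn pi).
    suff -> : pi (zvar F i ^+ p) = 0 by rewrite mul0r.
    by apply/piP; exact: I3_z_exp.
  rewrite piE; apply: (mul_prod_annihilate e_central (mem_index_enum i)).
  rewrite /e mulrBr mulr1 -exprD -mulnS prednK; last by rewrite ltnW // finNzRing_gt1.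
  apply/eqP; rewrite -oppr_eq0 opprB -!(rmorphXn pi) -(rmorphB pi); apply/eqP/piP.
  rewrite card_F; apply: I3_even_exp; exact: centred_homogeneous.
have E_central v : pi indicator * v = v * pi indicator.
  by rewrite piE; apply: prod_central.
have [c cE] := word_spanned nil2 E_central xE l.
exists c; apply/piP; rewrite (rmorphM pi) (rmorphB pi) (rmorph_prod pi) mulrBl cE.
apply/eqP; rewrite subr_eq0 (raddf_sum pi); apply/eqP; congr (_ * _).
by apply: eq_bigr => i _; rewrite -(rmorph_lie_monomial pi) (raddfMz pi).
Qed.

Lemma indicator_spanned f :
    (forall m, m \in msupp f -> exists l : seq T, m = FMonom (map (@var_index n) l)) ->
  span_modulo I (fun i : index => lie_monomial centred i) indicator f.
Proof.
move=> f_n; rewrite [f]monalgE big_seq; apply: big_ind.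
- by apply: span_modulo0; exact: I3_0.
- by move=> g h; apply: span_moduloD; exact: I3D.
move=> m /f_n[l ->]; rewrite -scale_word; apply: span_moduloZ; first exact: I3Z.
have -> : word F (map (@var_index n) l) = \prod_(t <- l) (centred t + (shift t)%:A).
  by rewrite /word big_map; apply: eq_bigr => t _; rewrite /centred subrK.
apply: words_translate.
- exact: free_scalerAr.
- by move=> g h; apply: span_moduloD; exact: I3D.
- by move=> c g; apply: span_moduloZ; exact: I3Z.
move=> {}l; have [c Ic] := indicator_word_spanned l.
exists (fun i => (c i)%:~R); suff <- : \sum_i lie_monomial centred i *~ c i =
    \sum_i (c i)%:~R *: lie_monomial centred i by [].
by apply: eq_bigr => i _; rewrite scaler_int.
Qed.

(** Discard the normal monomials lying in I, then evaluate at s + a for nilpotent s: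
    f vanishes, the indicator becomes 1, and independence applies. *)
Lemma T2_indicator f :
    (forall m, m \in msupp f -> exists l : seq T, m = FMonom (map (@var_index n) l)) ->
  T2G f -> I (f * indicator).
Proof.
move=> f_n f_T2; have [c Ic] := indicator_spanned f_n.
pose adm (i : index) := (z_degree i.1 i.2 <= k)%N && ~~ odd #|i.2|.
pose c' i := if adm i then c i else 0.
have Ic' : I ((f - \sum_i c' i *: lie_monomial centred i) * indicator).
  apply: (span_modulo_eq (@I3D F p q k) (@I3Z F p q k) _ _ _ Ic).
  - move=> i; rewrite /c' /adm; case: ifP => [_|/negbT]; first by right.
    rewrite negb_and negbK -ltnNge => /orP[ltk|oddJ]; left.
      exact: I3_lie_monomial_z.
    by rewrite /lie_monomial lie_prod_odd ?mulr0 ?size_map -?cardE //; exact: I3_0.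
  - by move=> g; apply: I3Mr.
  - exact: I3_0.
suff c'0 i : c' i = 0.
  move: Ic'; rewrite big1 => [|i _]; first by rewrite subr0.
  by rewrite c'0 scale0r.
have two0 := two_neq0 char_F p_gt2.
apply: (lie_monomials_independent (k := k) char_F p_gt2 two0 (c := c')) => {i}.
  by move=> i; rewrite /c' /adm; case: ifP => [/andP[]|]; rewrite ?eqxx.
move=> s [evs ods] nil_s.
(* Scalars are even, so s' is still admissible, and it sends y_i - a_i to s(y_i). *)
pose s' v : G := s v + (if v is inl i then oapp a 0 (insub i) else 0)%:A.
have even_s' i : even_component (@gphi F k) (s' (inl i)).
  apply/(even_componentP k two0); rewrite linearD linearZ rmorph1.
  by congr (_ + _); apply/(even_componentP k two0).
have odd_s' i : odd_component (@gphi F k) (s' (inr i)).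
  by rewrite /s' scale0r addr0.
have := I3_sub_T2 card_F char_F p_gt2 Ic' even_s' odd_s'.
rewrite (rmorphM (subst s')) (rmorphB (subst s')) /= (f_T2 _ even_s' odd_s') sub0r.
have xs' t : subst s' (centred t) = s (var_index t).
  rewrite /centred (linearB (subst s')) (linearZ_LR (subst s')) /= rmorph1 subst_var.
  by case: t => i; rewrite /s' /= ?valK /= ?scale0r addrK.
have -> : subst s' indicator = 1.
  rewrite (rmorph_prod (subst s')) big1 // => i _.
  rewrite (rmorphB (subst s')) (rmorphXn (subst s')) rmorph1 /=.
  rewrite [subst s' _](xs' (inl i)) exprM nil_s expr0n.
  by rewrite -eqSS prednK ?(gtn_eqF (finNzRing_gt1 F)) ?subr0 // ltnW // finNzRing_gt1.
rewrite mulr1 => /eqP; rewrite oppr_eq0 => /eqP e; rewrite -[RHS]e.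
rewrite (linear_sum (subst s')); apply: eq_bigr => i _.
rewrite (linearZ_LR (subst s')) /=; congr (_ *: _).
rewrite (rmorph_lie_monomial (subst s')) /lie_monomial.
congr (_ * lie_prod _); first by apply: eq_bigr => t _; rewrite /= xs'.
by apply: eq_map => t; rewrite /= xs'.
Qed.

End Localized.

(** Distribute the product over i of the sums of indicators, each equal to 1. *)
Lemma sum_indicator n : \sum_(a : {ffun 'I_n -> F}) indicator a = 1.
Proof.
rewrite /indicator -(bigA_distr_bigA (fun (i : 'I_n) (b : F) =>
  1 - (yvar F i - b%:A) ^+ (p * #|F|.-1))) big1 // => i _.
apply: sum_indicators => //; exact: free_scalerAr.
Qed.

Lemma var_indexP n (w : seq variable) :
    all (fun v : variable => match v with inl i | inr i => (i < n)%N end) w ->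
  exists l : seq ('I_n + 'I_n), w = map (@var_index n) l.
Proof.
elim: w => [|v w IH] /=; first by exists [::].
case/andP => vn /IH[l ->]; case: v vn => i ltin.
  by exists (inl (Ordinal ltin) :: l).
by exists (inr (Ordinal ltin) :: l).
Qed.

(** Add up the pieces f e_a over all choices of scalars a_i for the variables y_i
    that occur in f. *)
Lemma T2_sub_I3 f : T2G f -> I f.
Proof.
move=> f_T2; pose idx (v : variable) : nat := match v with inl i | inr i => i end.
pose n := (\max_(m <- msupp f) \max_(v <- m) idx v)%N.+1.
rewrite -[f]mulr1 -(sum_indicator n) mulr_sumr; apply: big_ind.
- exact: I3_0.
- exact: I3D.
move=> a _; apply: T2_indicator => // m mf.
have [|l ml] := @var_indexP n m; last by exists l; rewrite -ml fmK.
apply/allP => v vm; have : (idx v < n)%N.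
  rewrite ltnS; apply: (@leq_trans (\max_(u <- m) idx u)%N).
    exact: (@leq_bigmax_seq _ _ predT idx v vm isT).
  exact: (@leq_bigmax_seq _ _ predT (fun w => \max_(u <- fmonom_val w) idx u)%N m mf isT).
by case: v {vm}.
Qed.

End Completeness.

Theorem theorem3p7 (F : finFieldType) (p q k : nat)
    (card_F : #|F| = q) (char_F : p \in [pchar F]) (p_gt2 : (2 < p)%N) :
  T2 (even_component (@gphi F k)) (odd_component (@gphi F k)) = I3 p q k.
Proof.
apply/seteqP; split=> f; first exact: T2_sub_I3.
exact: I3_sub_T2.
Qed.
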